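(* Let $C$ be a coherence-3-system of a tricategory $\mathtt T$. 1. There is a tricategory $\mathtt T/C$ whose objects and 1-morphisms are those of $\mathtt T$, and whose 2- and 3-morphisms are the equivalence classes $[\alpha]$, $[\Pi]$ of 2- and 3-morphisms of $\mathtt T$ with respect to the relations $\sim_2$ and $\sim_3$ determined by $C$ (objects $a$ and 1-morphisms $f$ regarded in $\mathtt T/C$ are also written $[a]$, $[f]$), with the following remaining data. Sources and targets: $s[\alpha]=s\alpha$, $t[\alpha]=t\alpha$, $s[\Pi]=[s\Pi]$, $t[\Pi]=[t\Pi]$. Composition: $[\alpha]\otimes[\beta]=[\alpha\otimes\beta]$, $[\alpha]*[\beta]=[\alpha*\beta]$, $[\Pi]\otimes[\Lambda]=[\Pi\otimes\Lambda]$, $[\Pi]*[\Lambda]=[\Pi*\Lambda]$; and if $s[\Pi]=t[\Lambda]$, then there exist $\circ$-composable $\Pi',\Lambda'$ with $[\Pi']=[\Pi]$, $[\Lambda']=[\Lambda]$, and $[\Pi]\circ[\Lambda]=[\Pi'\circ\Lambda']$. Units and constraint cells are the classes of the corresponding cells of $\mathtt T$: $1_{[a]}=[1_a]$, $1_{[f]}=[1_f]$, $a_{[\alpha][\beta][\gamma]}=[a_{\alpha\beta\gamma}]$, $\rho_{[f],[g]}=[\rho_{f,g}]$, and likewise for all others. 2. Mapping each morphism of $\mathtt T$ to its equivalence class defines a virtually strict triequivalence $[-]:\mathtt T\to\mathtt T/C$.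
   Context: Tricategories are in the fully algebraic sense of Gurski: objects, local bicategories $\mathtt T(a,b)$, weak functors $\otimes$ (composition) and $I_a:\mathtt 1\to\mathtt T(a,a)$ (units), adjoint equivalences $a\dashv a^{\blacksquare}$, $l\dashv l^{\blacksquare}$, $r\dashv r^{\blacksquare}$ (with units $\eta^a,\eta^l,\eta^r$ and counits $\epsilon^a,\epsilon^l,\epsilon^r$) in functor bicategories, and invertible modifications $\pi,\mu,\lambda,\rho$, subject to the usual three axioms. Composition along objects, 1-morphisms, 2-morphisms is written $\otimes,*,\circ$; $s,t$ denote source and target; morphisms are parallel if they have the same source and target. Write $1_a=I_a(\bullet)$, $i_a=I_a(1_\bullet):1_a\to 1_a$, $\phi_a:1_{1_a}\to i_a$. The constraint cells are $i_a$, $\phi_a$, components of the local constraints $a^{loc},l^{loc},r^{loc}$, the interchangers $\phi^\otimes_{(\alpha,\beta)(\alpha',\beta')}:(\alpha\otimes\beta)*(\alpha'\otimes\beta')\to(\alpha*\alpha')\otimes(\beta*\beta')$, the cells $\phi^\otimes_{(f,g)}:1_{f\otimes g}\to 1_f\otimes 1_g$, and all components of $a,a^\blacksquare,l,l^\blacksquare,r,r^\blacksquare,\eta^a,\epsilon^a,\eta^l,\epsilon^l,\eta^r,\epsilon^r,\pi,\mu,\lambda,\rho$. A coherence-3-system of $\mathtt T$ is a collection $C$ of 3-morphisms of $\mathtt T$ such that: (1) $C$ is closed under $\otimes,*,\circ$; (2) $1_\alpha\in C$ for all 2-morphisms $\alpha$; (3) every $\Gamma\in C$ is invertible and $\Gamma^{-1}\in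 C$; (4) parallel elements of $C$ are equal. It determines the relations: for 2-morphisms, $\alpha\sim_2\beta$ iff there is $\Gamma\in C$ with $\Gamma:\alpha\to\beta$; for 3-morphisms, $\Pi\sim_3\Lambda$ iff there are $\Gamma,\Gamma'\in C$ with $\Gamma\circ\Pi\circ\Gamma'=\Lambda$. Virtually strict functor $F:\mathtt T\to\mathtt T'$: assignments on objects, 1-, 2-, 3-morphisms preserving sources and targets, strictly preserving $\otimes,*,\circ$, all units and all constraint cells. It is a virtually strict triequivalence if every object $a'$ of $\mathtt T'$ admits an object $a$ of $\mathtt T$ and a biequivalence $Fa\to a'$ in $\mathtt T'$, and each $\mathtt T(a,b)\to\mathtt T'(Fa,Fb)$ is a strict functor of bicategories which is a biequivalence (surjective on objects up to equivalence, essentially surjective on local categories, bijective on sets of 2-cells). *)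

(* Defs.v *)
Set Implicit Arguments.
Unset Strict Implicit.
Unset Printing Implicit Defensive.

Declare Scope cell_scope.
Delimit Scope cell_scope with cell.
Local Open Scope cell_scope.

Reserved Notation "g ∗ f" (at level 40, no associativity).
Reserved Notation "n ∗₂ m" (at level 40, no associativity).
Reserved Notation "n ∘ m" (at level 50, left associativity).
Reserved Notation "f ⊗ g" (at level 36, no associativity).
Reserved Notation "α ⊗₁ β" (at level 36, no associativity).
Reserved Notation "Π ⊗₂ Λ" (at level 36, no associativity).
Reserved Notation "P ⊠ Q" (at level 36, no associativity).
Reserved Notation "t ⊠₁ s" (at level 36, no associativity).
Reserved Notation "s • t" (at level 45, right associativity).
Reserved Notation "B × C" (at level 39, right associativity).

Record gset2 := GSet2 {
  cell0 :> Type;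
  cell1 : cell0 -> cell0 -> Type;
  cell2 : forall x y : cell0, cell1 x y -> cell1 x y -> Type }.
Arguments cell1 {g} x y.
Arguments cell2 {g x y} f h.

(* Heterogeneous equality of cells: same boundary and same cell. *)
Inductive eq1 (G : gset2) (x y : G) (f : cell1 x y) :
    forall x' y' : G, cell1 x' y' -> Prop :=
  eq1_refl : eq1 f f.

Inductive eq2 (G : gset2) (x y : G) (f g : cell1 x y) (m : cell2 f g) :
    forall (x' y' : G) (f' g' : cell1 x' y'), cell2 f' g' -> Prop :=
  eq2_refl : eq2 m m.

(* All compositions are written in functional order.  Inverses of constraint
   cells are fields; the equations determine them uniquely. *)
Record bicat_on (G : gset2) := BicatOn {
  id1_on : forall x : G, cell1 x x;
  comp1_on : forall x y z : G, cell1 y z -> cell1 x y -> cell1 x z;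
  id2_on : forall (x y : G) (f : cell1 x y), cell2 f f;
  vcomp_on : forall (x y : G) (f g h : cell1 x y),
    cell2 g h -> cell2 f g -> cell2 f h;
  hcomp_on : forall (x y z : G) (g g' : cell1 y z) (f f' : cell1 x y),
    cell2 g g' -> cell2 f f' -> cell2 (comp1_on g f) (comp1_on g' f');
  assoc_on : forall (w x y z : G)
    (h : cell1 y z) (g : cell1 x y) (f : cell1 w x),
    cell2 (comp1_on (comp1_on h g) f) (comp1_on h (comp1_on g f));
  assocV_on : forall (w x y z : G)
    (h : cell1 y z) (g : cell1 x y) (f : cell1 w x),
    cell2 (comp1_on h (comp1_on g f)) (comp1_on (comp1_on h g) f);
  lunit_on : forall (x y : G) (f : cell1 x y),
    cell2 (comp1_on (id1_on y) f) f;
  lunitV_on : forall (x y : G) (f : cell1 x y),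
    cell2 f (comp1_on (id1_on y) f);
  runit_on : forall (x y : G) (f : cell1 x y),
    cell2 (comp1_on f (id1_on x)) f;
  runitV_on : forall (x y : G) (f : cell1 x y),
    cell2 f (comp1_on f (id1_on x));

  vcompA_on : forall (x y : G) (f g h k : cell1 x y)
    (p : cell2 h k) (n : cell2 g h) (m : cell2 f g),
    vcomp_on (vcomp_on p n) m = vcomp_on p (vcomp_on n m);
  vcompIl_on : forall (x y : G) (f g : cell1 x y) (m : cell2 f g),
    vcomp_on (id2_on g) m = m;
  vcompIr_on : forall (x y : G) (f g : cell1 x y) (m : cell2 f g),
    vcomp_on m (id2_on f) = m;
  hcompI_on : forall (x y z : G) (g : cell1 y z) (f : cell1 x y),
    hcomp_on (id2_on g) (id2_on f) = id2_on (comp1_on g f);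
  interchange_on : forall (x y z : G)
    (g g' g'' : cell1 y z) (f f' f'' : cell1 x y)
    (n' : cell2 g' g'') (n : cell2 g g') (m' : cell2 f' f'') (m : cell2 f f'),
    hcomp_on (vcomp_on n' n) (vcomp_on m' m) =
    vcomp_on (hcomp_on n' m') (hcomp_on n m);
  assoc_nat_on : forall (w x y z : G) (h h' : cell1 y z) (g g' : cell1 x y)
    (f f' : cell1 w x) (p : cell2 h h') (n : cell2 g g') (m : cell2 f f'),
    vcomp_on (assoc_on h' g' f') (hcomp_on (hcomp_on p n) m) =
    vcomp_on (hcomp_on p (hcomp_on n m)) (assoc_on h g f);
  lunit_nat_on : forall (x y : G) (f g : cell1 x y) (m : cell2 f g),
    vcomp_on (lunit_on g) (hcomp_on (id2_on (id1_on y)) m) =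
    vcomp_on m (lunit_on f);
  runit_nat_on : forall (x y : G) (f g : cell1 x y) (m : cell2 f g),
    vcomp_on (runit_on g) (hcomp_on m (id2_on (id1_on x))) =
    vcomp_on m (runit_on f);
  assocK_on : forall (w x y z : G)
    (h : cell1 y z) (g : cell1 x y) (f : cell1 w x),
    vcomp_on (assocV_on h g f) (assoc_on h g f) = id2_on _;
  assocVK_on : forall (w x y z : G)
    (h : cell1 y z) (g : cell1 x y) (f : cell1 w x),
    vcomp_on (assoc_on h g f) (assocV_on h g f) = id2_on _;
  lunitK_on : forall (x y : G) (f : cell1 x y),
    vcomp_on (lunitV_on f) (lunit_on f) = id2_on _;
  lunitVK_on : forall (x y : G) (f : cell1 x y),
    vcomp_on (lunit_on f) (lunitV_on f) = id2_on _;
  runitK_on : forall (x y : G) (f : cell1 x y),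
    vcomp_on (runitV_on f) (runit_on f) = id2_on _;
  runitVK_on : forall (x y : G) (f : cell1 x y),
    vcomp_on (runit_on f) (runitV_on f) = id2_on _;
  pentagon_on : forall (v w x y z : G) (k : cell1 y z) (h : cell1 x y)
    (g : cell1 w x) (f : cell1 v w),
    vcomp_on (assoc_on k h (comp1_on g f)) (assoc_on (comp1_on k h) g f) =
    vcomp_on (hcomp_on (id2_on k) (assoc_on h g f))
      (vcomp_on (assoc_on k (comp1_on h g) f)
        (hcomp_on (assoc_on k h g) (id2_on f)));
  triangle_on : forall (x y z : G) (g : cell1 y z) (f : cell1 x y),
    vcomp_on (hcomp_on (id2_on g) (lunit_on f)) (assoc_on g (id1_on y) f) =
    hcomp_on (runit_on g) (id2_on f) }.

Record bicat := Bicat { carrier :> gset2; bicat_str : bicat_on carrier }.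

Section BicatOps.
Context {B : bicat}.
Definition id1 (x : B) : cell1 x x := id1_on (bicat_str B) x.
Definition comp1 (x y z : B) (g : cell1 y z) (f : cell1 x y) : cell1 x z :=
  comp1_on (bicat_str B) g f.
Definition id2 (x y : B) (f : cell1 x y) : cell2 f f := id2_on (bicat_str B) f.
Definition vcomp (x y : B) (f g h : cell1 x y)
  (n : cell2 g h) (m : cell2 f g) : cell2 f h := vcomp_on (bicat_str B) n m.
Definition hcomp (x y z : B) (g g' : cell1 y z) (f f' : cell1 x y)
  (n : cell2 g g') (m : cell2 f f') : cell2 (comp1 g f) (comp1 g' f') :=
  hcomp_on (bicat_str B) n m.
Definition assoc (w x y z : B)
  (h : cell1 y z) (g : cell1 x y) (f : cell1 w x) :
  cell2 (comp1 (comp1 h g) f) (comp1 h (comp1 g f)) :=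
  assoc_on (bicat_str B) h g f.
Definition assocV (w x y z : B)
  (h : cell1 y z) (g : cell1 x y) (f : cell1 w x) :
  cell2 (comp1 h (comp1 g f)) (comp1 (comp1 h g) f) :=
  assocV_on (bicat_str B) h g f.
Definition lunit (x y : B) (f : cell1 x y) : cell2 (comp1 (id1 y) f) f :=
  lunit_on (bicat_str B) f.
Definition lunitV (x y : B) (f : cell1 x y) : cell2 f (comp1 (id1 y) f) :=
  lunitV_on (bicat_str B) f.
Definition runit (x y : B) (f : cell1 x y) : cell2 (comp1 f (id1 x)) f :=
  runit_on (bicat_str B) f.
Definition runitV (x y : B) (f : cell1 x y) : cell2 f (comp1 f (id1 x)) :=
  runitV_on (bicat_str B) f.
End BicatOps.

Notation "g ∗ f" := (comp1 g f) : cell_scope.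
Notation "n ∗₂ m" := (hcomp n m) : cell_scope.
Notation "n ∘ m" := (vcomp n m) : cell_scope.

Definition invertible2 (B : bicat) (x y : B) (f g : cell1 x y)
    (m : cell2 f g) : Prop :=
  exists n : cell2 g f, n ∘ m = id2 f /\ m ∘ n = id2 g.

Definition iso1 (B : bicat) (x y : B) (f g : cell1 x y) : Prop :=
  exists m : cell2 f g, invertible2 m.

Definition equivalent (B : bicat) (x y : B) : Prop :=
  exists (f : cell1 x y) (g : cell1 y x),
    iso1 (id1 x) (g ∗ f) /\ iso1 (f ∗ g) (id1 y).

Definition prod_gset2 (G H : gset2) : gset2 :=
  GSet2 (cell0 := (G * H)%type)
    (cell1 := fun p q =>
       (@cell1 G (fst p) (fst q) * @cell1 H (snd p) (snd q))%type)
    (fun p q f g => (cell2 (fst f) (fst g) * cell2 (snd f) (snd g))%type).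

Definition prod_bicat_on (B C : bicat) :
  bicat_on (prod_gset2 (carrier B) (carrier C)).
Proof.
refine (@BicatOn (prod_gset2 (carrier B) (carrier C))
  (fun x => (id1 (fst x), id1 (snd x)))
  (fun x y z g f => (fst g ∗ fst f, snd g ∗ snd f))
  (fun x y f => (id2 (fst f), id2 (snd f)))
  (fun x y f g h n m => (fst n ∘ fst m, snd n ∘ snd m))
  (fun x y z g g' f f' n m => (fst n ∗₂ fst m, snd n ∗₂ snd m))
  (fun w x y z h g f =>
     (assoc (fst h) (fst g) (fst f), assoc (snd h) (snd g) (snd f)))
  (fun w x y z h g f =>
     (assocV (fst h) (fst g) (fst f), assocV (snd h) (snd g) (snd f)))
  (fun x y f => (lunit (fst f), lunit (snd f)))
  (fun x y f => (lunitV (fst f), lunitV (snd f)))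
  (fun x y f => (runit (fst f), runit (snd f)))
  (fun x y f => (runitV (fst f), runitV (snd f)))
  _ _ _ _ _ _ _ _ _ _ _ _ _ _ _ _); intros; cbn.
- f_equal; apply vcompA_on.
- destruct m; f_equal; apply vcompIl_on.
- destruct m; f_equal; apply vcompIr_on.
- f_equal; apply hcompI_on.
- f_equal; apply interchange_on.
- f_equal; apply assoc_nat_on.
- f_equal; apply lunit_nat_on.
- f_equal; apply runit_nat_on.
- f_equal; apply assocK_on.
- f_equal; apply assocVK_on.
- f_equal; apply lunitK_on.
- f_equal; apply lunitVK_on.
- f_equal; apply runitK_on.
- f_equal; apply runitVK_on.
- f_equal; apply pentagon_on.
- f_equal; apply triangle_on.
Defined.

Definition prod_bicat (B C : bicat) : bicat := Bicat (prod_bicat_on B C).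
Notation "B × C" := (prod_bicat B C) : cell_scope.

Definition one_gset2 : gset2 :=
  GSet2 (cell0 := unit) (cell1 := fun _ _ => unit) (fun _ _ _ _ => unit).

Definition one_bicat_on : bicat_on one_gset2.
Proof.
refine (@BicatOn one_gset2 (fun _ => tt) (fun _ _ _ _ _ => tt)
  (fun _ _ _ => tt) (fun _ _ _ _ _ _ _ => tt)
  (fun _ _ _ _ _ _ _ _ _ => tt)
  (fun _ _ _ _ _ _ _ => tt) (fun _ _ _ _ _ _ _ => tt)
  (fun _ _ _ => tt) (fun _ _ _ => tt) (fun _ _ _ => tt) (fun _ _ _ => tt)
  _ _ _ _ _ _ _ _ _ _ _ _ _ _ _ _);
  intros; cbn; try match goal with |- ?l = ?r => destruct l, r end; reflexivity.
Defined.

Definition one_bicat : bicat := Bicat one_bicat_on.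

(* Data and axioms of functors and transformations are kept apart: composites
   are only needed as sources and targets, where the axioms play no role. *)
Record fdata (B C : bicat) := FData {
  f0 :> B -> C;
  f1 : forall x y : B, cell1 x y -> cell1 (f0 x) (f0 y);
  f2 : forall (x y : B) (f g : cell1 x y), cell2 f g -> cell2 (f1 f) (f1 g);
  fcomp : forall (x y z : B) (g : cell1 y z) (f : cell1 x y),
    cell2 (f1 g ∗ f1 f) (f1 (g ∗ f));
  fid : forall x : B, cell2 (id1 (f0 x)) (f1 (id1 x)) }.

Record pfun (B C : bicat) := PFun {
  pfun_data :> fdata B C;
  fcompV : forall (x y z : B) (g : cell1 y z) (f : cell1 x y),
    cell2 (f1 pfun_data (g ∗ f)) (f1 pfun_data g ∗ f1 pfun_data f);
  fidV : forall x : B, cell2 (f1 pfun_data (id1 x)) (id1 (pfun_data x));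
  f2_id : forall (x y : B) (f : cell1 x y),
    f2 pfun_data (id2 f) = id2 (f1 pfun_data f);
  f2_vcomp : forall (x y : B) (f g h : cell1 x y)
    (n : cell2 g h) (m : cell2 f g),
    f2 pfun_data (n ∘ m) = f2 pfun_data n ∘ f2 pfun_data m;
  fcomp_nat : forall (x y z : B) (g g' : cell1 y z) (f f' : cell1 x y)
    (n : cell2 g g') (m : cell2 f f'),
    fcomp pfun_data g' f' ∘ (f2 pfun_data n ∗₂ f2 pfun_data m) =
    f2 pfun_data (n ∗₂ m) ∘ fcomp pfun_data g f;
  fcompK : forall (x y z : B) (g : cell1 y z) (f : cell1 x y),
    fcompV g f ∘ fcomp pfun_data g f = id2 _;
  fcompVK : forall (x y z : B) (g : cell1 y z) (f : cell1 x y),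
    fcomp pfun_data g f ∘ fcompV g f = id2 _;
  fidK : forall x : B, fidV x ∘ fid pfun_data x = id2 _;
  fidVK : forall x : B, fid pfun_data x ∘ fidV x = id2 _;
  fcomp_assoc : forall (w x y z : B)
    (h : cell1 y z) (g : cell1 x y) (f : cell1 w x),
    f2 pfun_data (assoc h g f) ∘ fcomp pfun_data (h ∗ g) f
      ∘ (fcomp pfun_data h g ∗₂ id2 (f1 pfun_data f)) =
    fcomp pfun_data h (g ∗ f)
      ∘ (id2 (f1 pfun_data h) ∗₂ fcomp pfun_data g f) ∘ assoc _ _ _;
  fid_l : forall (x y : B) (f : cell1 x y),
    f2 pfun_data (lunit f) ∘ fcomp pfun_data (id1 y) f
      ∘ (fid pfun_data y ∗₂ id2 (f1 pfun_data f)) = lunit (f1 pfun_data f);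
  fid_r : forall (x y : B) (f : cell1 x y),
    f2 pfun_data (runit f) ∘ fcomp pfun_data f (id1 x)
      ∘ (id2 (f1 pfun_data f) ∗₂ fid pfun_data x) = runit (f1 pfun_data f) }.

Definition fident (B : bicat) : fdata B B :=
  FData (f0 := fun x => x) (f1 := fun _ _ f => f) (fun _ _ _ _ m => m)
    (fun _ _ _ g f => id2 (g ∗ f)) (fun x => id2 (id1 x)).

Definition fcompose (B C D : bicat) (G : fdata C D) (F : fdata B C) :
    fdata B D :=
  FData (f0 := fun x => G (F x)) (f1 := fun _ _ f => f1 G (f1 F f))
    (fun _ _ _ _ m => f2 G (f2 F m))
    (fun _ _ _ g f => f2 G (fcomp F g f) ∘ fcomp G (f1 F g) (f1 F f))
    (fun x => f2 G (fid F x) ∘ fid G (F x)).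

Definition ffst (B C : bicat) : fdata (B × C) B :=
  @FData (B × C) B (fun x => fst x) (fun _ _ f => fst f)
    (fun _ _ _ _ m => fst m)
    (fun _ _ _ g f => id2 _) (fun x => id2 _).

Definition fsnd (B C : bicat) : fdata (B × C) C :=
  @FData (B × C) C (fun x => snd x) (fun _ _ f => snd f)
    (fun _ _ _ _ m => snd m)
    (fun _ _ _ g f => id2 _) (fun x => id2 _).

Definition fpair (X B C : bicat) (P : fdata X B) (Q : fdata X C) :
    fdata X (B × C) :=
  @FData X (B × C) (fun x => (P x, Q x)) (fun _ _ f => (f1 P f, f1 Q f))
    (fun _ _ _ _ m => (f2 P m, f2 Q m))
    (fun _ _ _ g f => (fcomp P g f, fcomp Q g f))
    (fun x => (fid P x, fid Q x)).

Definition fbang (X : bicat) : fdata X one_bicat :=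
  @FData X one_bicat (fun _ => tt) (fun _ _ _ => tt) (fun _ _ _ _ _ => tt)
    (fun _ _ _ _ _ => tt) (fun _ => tt).

Record tdata (B C : bicat) (F G : fdata B C) := TData {
  tc :> forall x : B, cell1 (F x) (G x);
  tn : forall (x y : B) (f : cell1 x y),
    cell2 (f1 G f ∗ tc x) (tc y ∗ f1 F f) }.

Record trans (B C : bicat) (F G : fdata B C) := Trans {
  trans_data :> tdata F G;
  tnV : forall (x y : B) (f : cell1 x y),
    cell2 (trans_data y ∗ f1 F f) (f1 G f ∗ trans_data x);
  tnK : forall (x y : B) (f : cell1 x y),
    tnV f ∘ tn trans_data f = id2 _;
  tnVK : forall (x y : B) (f : cell1 x y),
    tn trans_data f ∘ tnV f = id2 _;
  tn_nat : forall (x y : B) (f g : cell1 x y) (m : cell2 f g),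
    tn trans_data g ∘ (f2 G m ∗₂ id2 (trans_data x)) =
    (id2 (trans_data y) ∗₂ f2 F m) ∘ tn trans_data f;
  tn_comp : forall (x y z : B) (g : cell1 y z) (f : cell1 x y),
    tn trans_data (g ∗ f) ∘ (fcomp G g f ∗₂ id2 (trans_data x)) =
    (id2 (trans_data z) ∗₂ fcomp F g f) ∘ assoc _ _ _
      ∘ (tn trans_data g ∗₂ id2 (f1 F f)) ∘ assocV _ _ _
      ∘ (id2 (f1 G g) ∗₂ tn trans_data f) ∘ assoc _ _ _;
  tn_id : forall x : B,
    tn trans_data (id1 x) ∘ (fid G x ∗₂ id2 (trans_data x)) =
    (id2 (trans_data x) ∗₂ fid F x) ∘ runitV _ ∘ lunit _ }.

Definition tident (B C : bicat) (F : fdata B C) : tdata F F :=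
  TData (tc := fun x => id1 (F x)) (fun _ _ f => lunitV _ ∘ runit (f1 F f)).

Definition tcompose (B C : bicat) (F G H : fdata B C)
    (s : tdata G H) (t : tdata F G) : tdata F H :=
  TData (tc := fun x => s x ∗ t x)
    (fun x y f => assocV _ _ _ ∘ (id2 (s y) ∗₂ tn t f) ∘ assoc _ _ _
       ∘ (tn s f ∗₂ id2 (t x)) ∘ assocV _ _ _).
Notation "s • t" := (tcompose s t) : cell_scope.

Record inv_modif (B C : bicat) (F G : fdata B C) (t s : tdata F G) := InvModif {
  mc :> forall x : B, cell2 (t x) (s x);
  mcV : forall x : B, cell2 (s x) (t x);
  mcK : forall x : B, mcV x ∘ mc x = id2 _;
  mcVK : forall x : B, mc x ∘ mcV x = id2 _;
  mc_nat : forall (x y : B) (f : cell1 x y),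
    tn s f ∘ (id2 (f1 G f) ∗₂ mc x) = (mc y ∗₂ id2 (f1 F f)) ∘ tn t f }.

(* Adjoint equivalences in the functor bicategory: equations between
   modifications, such as the triangle identities, hold componentwise. *)
Record adjeqv (B C : bicat) (F G : fdata B C) := AdjEqv {
  fwd : trans F G;
  bwd : trans G F;
  aunit : inv_modif (tident F) (bwd • fwd);
  acounit : inv_modif (fwd • bwd) (tident G);
  triangle_fwd : forall x : B,
    (acounit x ∗₂ id2 (fwd x)) ∘ assocV _ _ _ ∘ (id2 (fwd x) ∗₂ aunit x) =
    lunitV _ ∘ runit (fwd x);
  triangle_bwd : forall x : B,
    (id2 (bwd x) ∗₂ acounit x) ∘ assoc _ _ _ ∘ (aunit x ∗₂ id2 (bwd x)) =
    runitV _ ∘ lunit (bwd x) }.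

(* The 1-, 2- and 3-morphisms are the 0-, 1- and 2-cells of the [hom a b].
   Hence ∗ (along 1-morphisms) and ∘ (along 2-morphisms) of a tricategory are
   the compositions of its local bicategories. *)
Record gset3 := GSet3 {
  obj :> Type;
  hom : obj -> obj -> gset2 }.
Arguments hom {g} a b.

Record tri_comp (G : gset3) := TriComp {
  loc : forall a b : G, bicat_on (hom a b);
  tensor : forall a b c : G,
    pfun (Bicat (loc b c) × Bicat (loc a b)) (Bicat (loc a c));
  tunit : forall a : G, pfun one_bicat (Bicat (loc a a)) }.

Section Composition.
Context {G : gset3} {K : tri_comp G}.

Definition Hom (a b : G) : bicat := Bicat (loc K a b).

Definition ten0 (a b c : G) (f : Hom b c) (g : Hom a b) : Hom a c :=
  f0 (tensor K a b c) (f, g).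

Definition ten1 (a b c : G) (f f' : Hom b c) (g g' : Hom a b)
    (α : cell1 f f') (β : cell1 g g') : cell1 (ten0 f g) (ten0 f' g') :=
  @f1 _ _ (tensor K a b c) (f, g) (f', g') (α, β).

Definition ten2 (a b c : G) (f f' : Hom b c) (g g' : Hom a b)
    (α α' : cell1 f f') (β β' : cell1 g g')
    (Π : cell2 α α') (Λ : cell2 β β') : cell2 (ten1 α β) (ten1 α' β') :=
  @f2 _ _ (tensor K a b c) (f, g) (f', g') (α, β) (α', β') (Π, Λ).

Definition one1 (a : G) : Hom a a := tunit K a tt.

Definition unit_i (a : G) : cell1 (one1 a) (one1 a) :=
  @f1 _ _ (tunit K a) tt tt tt.

Definition unit_phi (a : G) : cell2 (id1 (one1 a)) (unit_i a) :=
  @fid _ _ (tunit K a) tt.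

Local Notation "f ⊗ g" := (ten0 f g) : cell_scope.
Local Notation "α ⊗₁ β" := (ten1 α β) : cell_scope.
Local Notation "Π ⊗₂ Λ" := (ten2 Π Λ) : cell_scope.

Section Interchangers.
Variables (a b c : G) (f f' f'' : Hom b c) (g g' g'' : Hom a b).
Variables (α : cell1 f' f'') (β : cell1 g' g'').
Variables (α' : cell1 f f') (β' : cell1 g g').

Definition phi : cell2 ((α ⊗₁ β) ∗ (α' ⊗₁ β')) ((α ∗ α') ⊗₁ (β ∗ β')) :=
  @fcomp _ _ (tensor K a b c) (f, g) (f', g') (f'', g'') (α, β) (α', β').

Definition phiV : cell2 ((α ∗ α') ⊗₁ (β ∗ β')) ((α ⊗₁ β) ∗ (α' ⊗₁ β')) :=
  @fcompV _ _ (tensor K a b c) (f, g) (f', g') (f'', g'') (α, β) (α', β').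
End Interchangers.

Definition phi0 (a b c : G) (f : Hom b c) (g : Hom a b) :
  cell2 (id1 (f ⊗ g)) (id1 f ⊗₁ id1 g) :=
  @fid _ _ (tensor K a b c) (f, g).

Definition phi0V (a b c : G) (f : Hom b c) (g : Hom a b) :
  cell2 (id1 f ⊗₁ id1 g) (id1 (f ⊗ g)) :=
  @fidV _ _ (tensor K a b c) (f, g).

(* [P ⊠ Q] is ⊗ ∘ ⟨P, Q⟩, and [t ⊠₁ s] is ⊗ applied to ⟨t, s⟩. *)
Definition ften (X : bicat) (a b c : G)
    (P : fdata X (Hom b c)) (Q : fdata X (Hom a b)) : fdata X (Hom a c) :=
  fcompose (tensor K a b c) (fpair P Q).

Definition tten (X : bicat) (a b c : G)
    (P P' : fdata X (Hom b c)) (Q Q' : fdata X (Hom a b))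
    (t : tdata P P') (s : tdata Q Q') : tdata (ften P Q) (ften P' Q') :=
  @TData _ _ (ften P Q) (ften P' Q') (fun x => t x ⊗₁ s x)
    (fun x y u => phiV (t y) (s y) (f1 P u) (f1 Q u)
       ∘ (tn t u ⊗₂ tn s u) ∘ phi (f1 P' u) (f1 Q' u) (t x) (s x)).

Definition funit (X : bicat) (a : G) : fdata X (Hom a a) :=
  fcompose (tunit K a) (fbang X).

End Composition.

Arguments Hom {G} K a b.
Arguments one1 {G} K a.
Arguments unit_i {G} K a.
Arguments unit_phi {G} K a.
Arguments funit {G} K X a.
Notation "f ⊗ g" := (ten0 f g) : cell_scope.
Notation "α ⊗₁ β" := (ten1 α β) : cell_scope.
Notation "Π ⊗₂ Λ" := (ten2 Π Λ) : cell_scope.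
Notation "P ⊠ Q" := (ften P Q) : cell_scope.
Notation "t ⊠₁ s" := (tten t s) : cell_scope.

Notation pr1 := (ffst _ _).
Notation pr2 := (fcompose (ffst _ _) (fsnd _ _)).
Notation pr2last := (fsnd _ _).
Notation pr3 := (fcompose (ffst _ _) (fcompose (fsnd _ _) (fsnd _ _))).
Notation pr3last := (fcompose (fsnd _ _) (fsnd _ _)).
Notation pr4last := (fcompose (fsnd _ _) (fcompose (fsnd _ _) (fsnd _ _))).

Record tri_adj (G : gset3) := TriAdj {
  tri_base :> tri_comp G;
  aeqv : forall a b c d : G,
    adjeqv (B := Hom tri_base c d × Hom tri_base b c × Hom tri_base a b)
      ((pr1 ⊠ pr2) ⊠ pr3last) (pr1 ⊠ (pr2 ⊠ pr3last));
  leqv : forall a b : G,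
    adjeqv (B := Hom tri_base a b)
      (funit tri_base _ b ⊠ fident _) (fident _);
  reqv : forall a b : G,
    adjeqv (B := Hom tri_base a b)
      (fident _ ⊠ funit tri_base _ a) (fident _) }.

Section Whiskering.
Context {G : gset3} (T : tri_adj G).
Local Notation H := (Hom T).

Definition at_a (X : bicat) (a b c d : G) (P : fdata X (H c d))
    (Q : fdata X (H b c)) (R : fdata X (H a b)) :
    tdata ((P ⊠ Q) ⊠ R) (P ⊠ (Q ⊠ R)) :=
  @TData _ _ ((P ⊠ Q) ⊠ R) (P ⊠ (Q ⊠ R))
    (fun x => tc (fwd (aeqv T a b c d)) (P x, (Q x, R x)))
    (fun x y u => @tn _ _ _ _ (fwd (aeqv T a b c d))
       (P x, (Q x, R x)) (P y, (Q y, R y)) (f1 P u, (f1 Q u, f1 R u))).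

Definition at_l (X : bicat) (a b : G) (P : fdata X (H a b)) :
    tdata (funit T X b ⊠ P) P :=
  @TData _ _ (funit T X b ⊠ P) P
    (fun x => tc (fwd (leqv T a b)) (P x))
    (fun x y u => tn (fwd (leqv T a b)) (f1 P u)).

Definition at_rV (X : bicat) (a b : G) (P : fdata X (H a b)) :
    tdata P (P ⊠ funit T X a) :=
  @TData _ _ P (P ⊠ funit T X a)
    (fun x => tc (bwd (reqv T a b)) (P x))
    (fun x y u => tn (bwd (reqv T a b)) (f1 P u)).
End Whiskering.

Record tri_data (G : gset3) := TriData {
  tri_adj_of :> tri_adj G;
  pi : forall a b c d e : G,
    inv_modif (B := Hom tri_adj_of d e × Hom tri_adj_of c d
               × Hom tri_adj_of b c × Hom tri_adj_of a b)
      ((tident pr1 ⊠₁ at_a pr2 pr3 pr4last)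
         • at_a pr1 (pr2 ⊠ pr3) pr4last
         • (at_a pr1 pr2 pr3 ⊠₁ tident pr4last))
      (at_a pr1 pr2 (pr3 ⊠ pr4last)
         • at_a (pr1 ⊠ pr2) pr3 pr4last);
  mu : forall a b c : G,
    inv_modif (B := Hom tri_adj_of b c × Hom tri_adj_of a b)
      ((tident pr1 ⊠₁ at_l pr2last)
         • at_a pr1 (funit tri_adj_of _ b) pr2last
         • (at_rV pr1 ⊠₁ tident pr2last))
      (tident (pr1 ⊠ pr2last));
  lambda : forall a b c : G,
    inv_modif (B := Hom tri_adj_of b c × Hom tri_adj_of a b)
      (at_l pr1 ⊠₁ tident pr2last)
      (at_l (pr1 ⊠ pr2last)
         • at_a (funit tri_adj_of _ c) pr1 pr2last);
  rho : forall a b c : G,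
    inv_modif (B := Hom tri_adj_of b c × Hom tri_adj_of a b)
      (tident pr1 ⊠₁ at_rV pr2last)
      (at_a pr1 pr2last (funit tri_adj_of _ a)
         • at_rV (pr1 ⊠ pr2last)) }.

(* Pastings are written along right-nested composites of 2-morphisms; the
   maps below apply a 3-morphism to the first factors of such a composite. *)
Section Rewriting.
Context {B : bicat}.

Definition whl (x y z : B) (w : cell1 y z) (u v : cell1 x y) (m : cell2 u v) :
  cell2 (w ∗ u) (w ∗ v) := id2 w ∗₂ m.

Definition rw22 (o p p' q r : B) (x : cell1 q r) (y : cell1 p q)
    (x' : cell1 p' r) (y' : cell1 p p')
    (m : cell2 (x ∗ y) (x' ∗ y')) (w : cell1 o p) :
    cell2 (x ∗ (y ∗ w)) (x' ∗ (y' ∗ w)) :=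
  assoc x' y' w ∘ (m ∗₂ id2 w) ∘ assocV x y w.

Definition rw12 (o p p' q : B) (x : cell1 p q)
    (x' : cell1 p' q) (y' : cell1 p p')
    (m : cell2 x (x' ∗ y')) (w : cell1 o p) :
    cell2 (x ∗ w) (x' ∗ (y' ∗ w)) :=
  assoc x' y' w ∘ (m ∗₂ id2 w).

Definition nest3 (o p q r s : B) (x : cell1 r s) (y : cell1 q r)
    (z : cell1 p q) (w : cell1 o p) :
    cell2 (x ∗ (y ∗ (z ∗ w))) ((x ∗ (y ∗ z)) ∗ w) :=
  assocV x (y ∗ z) w ∘ (id2 x ∗₂ assocV y z w).

Definition rw32 (o p p' q r s : B) (x : cell1 r s) (y : cell1 q r)
    (z : cell1 p q) (x' : cell1 p' s) (y' : cell1 p p')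
    (m : cell2 (x ∗ (y ∗ z)) (x' ∗ y')) (w : cell1 o p) :
    cell2 (x ∗ (y ∗ (z ∗ w))) (x' ∗ (y' ∗ w)) :=
  assoc x' y' w ∘ (m ∗₂ id2 w) ∘ nest3 x y z w.

Definition rw30 (o p q r : B) (x : cell1 r p) (y : cell1 q r)
    (z : cell1 p q) (m : cell2 (x ∗ (y ∗ z)) (id1 p)) (w : cell1 o p) :
    cell2 (x ∗ (y ∗ (z ∗ w))) w :=
  lunit w ∘ (m ∗₂ id2 w) ∘ nest3 x y z w.
End Rewriting.

(* Tensoring a 3-morphism between composites with an identity 1-morphism,
   and redistributing the tensor over the composites. *)
Section TensorRewriting.
Context {G : gset3} {K : tri_comp G} {a b c : G}.

Section Right.
Variable f : Hom K a b.
Local Notation "x ⋆" := (x ⊗₁ id1 f) (at level 5, format "x ⋆").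

Definition merge_r (p q r : Hom K b c) (x : cell1 q r) (y : cell1 p q) :
    cell2 (x⋆ ∗ y⋆) ((x ∗ y)⋆) :=
  (id2 (x ∗ y) ⊗₂ lunit (id1 f)) ∘ phi x (id1 f) y (id1 f).

Definition split_r (p q r : Hom K b c) (x : cell1 q r) (y : cell1 p q) :
    cell2 ((x ∗ y)⋆) (x⋆ ∗ y⋆) :=
  phiV x (id1 f) y (id1 f) ∘ (id2 (x ∗ y) ⊗₂ lunitV (id1 f)).

Definition merge3_r (p q r s : Hom K b c)
    (x : cell1 r s) (y : cell1 q r) (z : cell1 p q) :
    cell2 (x⋆ ∗ (y⋆ ∗ z⋆)) ((x ∗ (y ∗ z))⋆) :=
  merge_r x (y ∗ z) ∘ whl (x⋆) (merge_r y z).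

Definition ten_r12 (p q r : Hom K b c) (x : cell1 p r)
    (x' : cell1 q r) (y' : cell1 p q) (m : cell2 x (x' ∗ y')) :
    cell2 (x⋆) (x'⋆ ∗ y'⋆) :=
  split_r x' y' ∘ (m ⊗₂ id2 (id1 f)).

Definition ten_r32 (p p' q r s : Hom K b c)
    (x : cell1 r s) (y : cell1 q r) (z : cell1 p q)
    (x' : cell1 p' s) (y' : cell1 p p')
    (m : cell2 (x ∗ (y ∗ z)) (x' ∗ y')) :
    cell2 (x⋆ ∗ (y⋆ ∗ z⋆)) (x'⋆ ∗ y'⋆) :=
  split_r x' y' ∘ (m ⊗₂ id2 (id1 f)) ∘ merge3_r x y z.

Definition ten_r30 (p q r : Hom K b c)
    (x : cell1 r p) (y : cell1 q r) (z : cell1 p q)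
    (m : cell2 (x ∗ (y ∗ z)) (id1 p)) :
    cell2 (x⋆ ∗ (y⋆ ∗ z⋆)) (id1 (p ⊗ f)) :=
  phi0V p f ∘ (m ⊗₂ id2 (id1 f)) ∘ merge3_r x y z.
End Right.

Section Left.
Variable f : Hom K b c.
Local Notation "⋆ x" := (id1 f ⊗₁ x) (at level 5, x at level 5, format "⋆ x").

Definition merge_l (p q r : Hom K a b) (x : cell1 q r) (y : cell1 p q) :
    cell2 (⋆x ∗ ⋆y) (⋆(x ∗ y)) :=
  (lunit (id1 f) ⊗₂ id2 (x ∗ y)) ∘ phi (id1 f) x (id1 f) y.

Definition split_l (p q r : Hom K a b) (x : cell1 q r) (y : cell1 p q) :
    cell2 (⋆(x ∗ y)) (⋆x ∗ ⋆y) :=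
  phiV (id1 f) x (id1 f) y ∘ (lunitV (id1 f) ⊗₂ id2 (x ∗ y)).

Definition merge3_l (p q r s : Hom K a b)
    (x : cell1 r s) (y : cell1 q r) (z : cell1 p q) :
    cell2 (⋆x ∗ (⋆y ∗ ⋆z)) (⋆(x ∗ (y ∗ z))) :=
  merge_l x (y ∗ z) ∘ whl (⋆x) (merge_l y z).

Definition ten_l12 (p q r : Hom K a b) (x : cell1 p r)
    (x' : cell1 q r) (y' : cell1 p q) (m : cell2 x (x' ∗ y')) :
    cell2 (⋆x) (⋆x' ∗ ⋆y') :=
  split_l x' y' ∘ (id2 (id1 f) ⊗₂ m).

Definition ten_l32 (p p' q r s : Hom K a b)
    (x : cell1 r s) (y : cell1 q r) (z : cell1 p q)
    (x' : cell1 p' s) (y' : cell1 p p')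
    (m : cell2 (x ∗ (y ∗ z)) (x' ∗ y')) :
    cell2 (⋆x ∗ (⋆y ∗ ⋆z)) (⋆x' ∗ ⋆y') :=
  split_l x' y' ∘ (id2 (id1 f) ⊗₂ m) ∘ merge3_l x y z.

Definition ten_l30 (p q r : Hom K a b)
    (x : cell1 r p) (y : cell1 q r) (z : cell1 p q)
    (m : cell2 (x ∗ (y ∗ z)) (id1 p)) :
    cell2 (⋆x ∗ (⋆y ∗ ⋆z)) (id1 (f ⊗ p)) :=
  phi0V f p ∘ (id2 (id1 f) ⊗₂ m) ∘ merge3_l x y z.
End Left.
End TensorRewriting.

Section Components.
Context {G : gset3} (T : tri_data G).
Local Notation H := (Hom T).

Section Associator.
Variables a b c d : G.

Definition a1 (h : H c d) (g : H b c) (f : H a b) :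
  cell1 ((h ⊗ g) ⊗ f) (h ⊗ (g ⊗ f)) := tc (fwd (aeqv T a b c d)) (h, (g, f)).

Definition aV1 (h : H c d) (g : H b c) (f : H a b) :
  cell1 (h ⊗ (g ⊗ f)) ((h ⊗ g) ⊗ f) := tc (bwd (aeqv T a b c d)) (h, (g, f)).

Definition a_eta (h : H c d) (g : H b c) (f : H a b) :
  cell2 (id1 ((h ⊗ g) ⊗ f)) (aV1 h g f ∗ a1 h g f) :=
  mc (aunit (aeqv T a b c d)) (h, (g, f)).

Definition a_eps (h : H c d) (g : H b c) (f : H a b) :
  cell2 (a1 h g f ∗ aV1 h g f) (id1 (h ⊗ (g ⊗ f))) :=
  mc (acounit (aeqv T a b c d)) (h, (g, f)).

Variables (h h' : H c d) (g g' : H b c) (f f' : H a b).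
Variables (α : cell1 h h') (β : cell1 g g') (γ : cell1 f f').

Definition a2 : cell2 ((α ⊗₁ (β ⊗₁ γ)) ∗ a1 h g f)
                      (a1 h' g' f' ∗ ((α ⊗₁ β) ⊗₁ γ)) :=
  @tn _ _ _ _ (fwd (aeqv T a b c d)) (h, (g, f)) (h', (g', f')) (α, (β, γ)).

Definition a2V : cell2 (a1 h' g' f' ∗ ((α ⊗₁ β) ⊗₁ γ))
                       ((α ⊗₁ (β ⊗₁ γ)) ∗ a1 h g f) :=
  @tnV _ _ _ _ (fwd (aeqv T a b c d)) (h, (g, f)) (h', (g', f')) (α, (β, γ)).

Definition aV2 : cell2 (((α ⊗₁ β) ⊗₁ γ) ∗ aV1 h g f)
                       (aV1 h' g' f' ∗ (α ⊗₁ (β ⊗₁ γ))) :=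
  @tn _ _ _ _ (bwd (aeqv T a b c d)) (h, (g, f)) (h', (g', f')) (α, (β, γ)).
End Associator.

Section Unitors.
Variables a b : G.

Definition l1 (f : H a b) : cell1 (one1 T b ⊗ f) f :=
  tc (fwd (leqv T a b)) f.
Definition lV1 (f : H a b) : cell1 f (one1 T b ⊗ f) :=
  tc (bwd (leqv T a b)) f.
Definition l_eta (f : H a b) : cell2 (id1 (one1 T b ⊗ f)) (lV1 f ∗ l1 f) :=
  mc (aunit (leqv T a b)) f.
Definition l_eps (f : H a b) : cell2 (l1 f ∗ lV1 f) (id1 f) :=
  mc (acounit (leqv T a b)) f.
Definition l2 (f f' : H a b) (α : cell1 f f') :
  cell2 (α ∗ l1 f) (l1 f' ∗ (unit_i T b ⊗₁ α)) := tn (fwd (leqv T a b)) α.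
Definition lV2 (f f' : H a b) (α : cell1 f f') :
  cell2 ((unit_i T b ⊗₁ α) ∗ lV1 f) (lV1 f' ∗ α) := tn (bwd (leqv T a b)) α.

Definition r1 (f : H a b) : cell1 (f ⊗ one1 T a) f :=
  tc (fwd (reqv T a b)) f.
Definition rV1 (f : H a b) : cell1 f (f ⊗ one1 T a) :=
  tc (bwd (reqv T a b)) f.
Definition r_eta (f : H a b) : cell2 (id1 (f ⊗ one1 T a)) (rV1 f ∗ r1 f) :=
  mc (aunit (reqv T a b)) f.
Definition r_eps (f : H a b) : cell2 (r1 f ∗ rV1 f) (id1 f) :=
  mc (acounit (reqv T a b)) f.
Definition r2 (f f' : H a b) (α : cell1 f f') :
  cell2 (α ∗ r1 f) (r1 f' ∗ (α ⊗₁ unit_i T a)) := tn (fwd (reqv T a b)) α.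
Definition rV2 (f f' : H a b) (α : cell1 f f') :
  cell2 ((α ⊗₁ unit_i T a) ∗ rV1 f) (rV1 f' ∗ α) := tn (bwd (reqv T a b)) α.
End Unitors.

Definition pi3 (a b c d e : G)
    (k : H d e) (h : H c d) (g : H b c) (f : H a b) :
    cell2 ((id1 k ⊗₁ a1 h g f) ∗ (a1 k (h ⊗ g) f ∗ (a1 k h g ⊗₁ id1 f)))
          (a1 k h (g ⊗ f) ∗ a1 (k ⊗ h) g f) :=
  mc (pi T a b c d e) (k, (h, (g, f))).

Definition mu3 (a b c : G) (g : H b c) (f : H a b) :
    cell2 ((id1 g ⊗₁ l1 f) ∗ (a1 g (one1 T b) f ∗ (rV1 g ⊗₁ id1 f)))
          (id1 (g ⊗ f)) :=
  mc (mu T a b c) (g, f).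

Definition lambda3 (a b c : G) (g : H b c) (f : H a b) :
    cell2 (l1 g ⊗₁ id1 f) (l1 (g ⊗ f) ∗ a1 (one1 T c) g f) :=
  mc (lambda T a b c) (g, f).

Definition rho3 (a b c : G) (g : H b c) (f : H a b) :
    cell2 (id1 g ⊗₁ rV1 f) (a1 g f (one1 T a) ∗ rV1 (g ⊗ f)) :=
  mc (rho T a b c) (g, f).

(* Naturality of a in one variable, with 1_f ⊗ 1_g replaced by 1_(f ⊗ g). *)
Definition a_left (a b c d : G) (h h' : H c d) (α : cell1 h h')
    (g : H b c) (f : H a b) :
    cell2 (a1 h' g f ∗ ((α ⊗₁ id1 g) ⊗₁ id1 f))
          ((α ⊗₁ id1 (g ⊗ f)) ∗ a1 h g f) :=
  ((id2 α ⊗₂ phi0V g f) ∗₂ id2 (a1 h g f)) ∘ a2V α (id1 g) (id1 f).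

Definition a_right (a b c d : G) (h : H c d) (g : H b c)
    (f f' : H a b) (γ : cell1 f f') :
    cell2 ((id1 h ⊗₁ (id1 g ⊗₁ γ)) ∗ a1 h g f)
          (a1 h g f' ∗ (id1 (h ⊗ g) ⊗₁ γ)) :=
  (id2 (a1 h g f') ∗₂ (phi0V h g ⊗₂ id2 γ)) ∘ a2 (id1 h) (id1 g) γ.

(* In each equation the two pastings run from the longest to the shortest
   right-nested composite of 2-morphisms on their common boundary. *)
Definition associahedron_axiom : Prop :=
  forall (a b c d e e' : G)
    (k : H e e') (j : H d e) (h : H c d) (g : H b c) (f : H a b),
  whl (a1 k j (h ⊗ (g ⊗ f))) (pi3 (k ⊗ j) h g f)
    ∘ rw22 (a_right k j (a1 h g f)) _
    ∘ whl (id1 k ⊗₁ (id1 j ⊗₁ a1 h g f))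
        (rw32 (pi3 k j (h ⊗ g) f) (a1 (k ⊗ j) h g ⊗₁ id1 f))
    ∘ whl (id1 k ⊗₁ (id1 j ⊗₁ a1 h g f))
        (whl (id1 k ⊗₁ a1 j (h ⊗ g) f)
          (whl (a1 k (j ⊗ (h ⊗ g)) f) (ten_r32 f (pi3 k j h g))))
  = rw32 (pi3 k j h (g ⊗ f)) (a1 ((k ⊗ j) ⊗ h) g f)
    ∘ whl (id1 k ⊗₁ a1 j h (g ⊗ f))
        (whl (a1 k (j ⊗ h) (g ⊗ f)) (a_left (a1 k j h) g f))
    ∘ whl (id1 k ⊗₁ a1 j h (g ⊗ f))
        (rw32 (pi3 k (j ⊗ h) g f) ((a1 k j h ⊗₁ id1 g) ⊗₁ id1 f))
    ∘ rw32 (ten_l32 k (pi3 j h g f)) _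
    ∘ whl (id1 k ⊗₁ (id1 j ⊗₁ a1 h g f))
        (whl (id1 k ⊗₁ a1 j (h ⊗ g) f)
          (rw22 (a2V (id1 k) (a1 j h g) (id1 f)) _)).

Definition left_normalization_axiom : Prop :=
  forall (a b c d : G) (h : H c d) (g : H b c) (f : H a b),
  runit (a1 h g f)
    ∘ whl (a1 h g f) (ten_r30 f (mu3 h g))
    ∘ rw22 (a2 (id1 h) (l1 g) (id1 f)) _
  = rw30 (mu3 h (g ⊗ f)) (a1 h g f)
    ∘ whl (id1 h ⊗₁ l1 (g ⊗ f))
        (whl (a1 h (one1 T c) (g ⊗ f)) (a_left (rV1 h) g f))
    ∘ whl (id1 h ⊗₁ l1 (g ⊗ f))
        (rw32 (pi3 h (one1 T c) g f) ((rV1 h ⊗₁ id1 g) ⊗₁ id1 f))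
    ∘ rw12 (ten_l12 h (lambda3 g f)) _.

Definition right_normalization_axiom : Prop :=
  forall (a b c d : G) (h : H c d) (g : H b c) (f : H a b),
  rw30 (ten_l30 h (mu3 g f)) (a1 h g f)
    ∘ whl (id1 h ⊗₁ (id1 g ⊗₁ l1 f))
        (whl (id1 h ⊗₁ a1 g (one1 T b) f)
          (a2V (id1 h) (rV1 g) (id1 f)))
  = runit (a1 h g f)
    ∘ whl (a1 h g f) (mu3 (h ⊗ g) f)
    ∘ rw22 (a_right h g (l1 f)) _
    ∘ whl (id1 h ⊗₁ (id1 g ⊗₁ l1 f))
        (rw32 (pi3 h g (one1 T b) f) (rV1 (h ⊗ g) ⊗₁ id1 f))
    ∘ whl (id1 h ⊗₁ (id1 g ⊗₁ l1 f))
        (whl (id1 h ⊗₁ a1 g (one1 T b) f)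
          (whl (a1 h (g ⊗ one1 T b) f) (ten_r12 f (rho3 h g)))).
End Components.

Record tricat_on (G : gset3) := TricatOn {
  tri_data_of :> tri_data G;
  associahedron : associahedron_axiom tri_data_of;
  left_normalization : left_normalization_axiom tri_data_of;
  right_normalization : right_normalization_axiom tri_data_of }.

Record gmap2 (G G' : gset2) := GMap2 {
  m0 :> G -> G';
  m1 : forall x y : G, cell1 x y -> cell1 (m0 x) (m0 y);
  m2 : forall (x y : G) (f g : cell1 x y), cell2 f g -> cell2 (m1 f) (m1 g) }.

Record gmap3 (G G' : gset3) := GMap3 {
  mobj :> G -> G';
  mhom : forall a b : G, gmap2 (hom a b) (hom (mobj a) (mobj b)) }.

Record strict_functor (B B' : bicat) (F : gmap2 B B') : Prop := StrictFunctor {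
  strict_id1 : forall x : B, m1 F (id1 x) = id1 (F x);
  strict_comp1 : forall (x y z : B) (g : cell1 y z) (f : cell1 x y),
    m1 F (g ∗ f) = m1 F g ∗ m1 F f;
  strict_id2 : forall (x y : B) (f : cell1 x y),
    m2 F (id2 f) = id2 (m1 F f);
  strict_vcomp : forall (x y : B) (f g h : cell1 x y)
    (n : cell2 g h) (m : cell2 f g), m2 F (n ∘ m) = m2 F n ∘ m2 F m;
  strict_hcomp : forall (x y z : B) (g g' : cell1 y z) (f f' : cell1 x y)
    (n : cell2 g g') (m : cell2 f f'),
    eq2 (m2 F (n ∗₂ m)) (m2 F n ∗₂ m2 F m);
  strict_assoc : forall (w x y z : B)
    (h : cell1 y z) (g : cell1 x y) (f : cell1 w x),
    eq2 (m2 F (assoc h g f)) (assoc (m1 F h) (m1 F g) (m1 F f));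
  strict_lunit : forall (x y : B) (f : cell1 x y),
    eq2 (m2 F (lunit f)) (lunit (m1 F f));
  strict_runit : forall (x y : B) (f : cell1 x y),
    eq2 (m2 F (runit f)) (runit (m1 F f)) }.

Record biequivalence2 (B B' : bicat) (F : gmap2 B B') : Prop := Biequivalence2 {
  beq_surj0 : forall y : B', exists x : B, equivalent (F x) y;
  beq_surj1 : forall (x x' : B) (f' : cell1 (F x) (F x')),
    exists f : cell1 x x', iso1 (m1 F f) f';
  beq_inj2 : forall (x x' : B) (f g : cell1 x x') (m n : cell2 f g),
    m2 F m = m2 F n -> m = n;
  beq_surj2 : forall (x x' : B) (f g : cell1 x x')
    (m' : cell2 (m1 F f) (m1 F g)), exists m : cell2 f g, m2 F m = m' }.

Definition biequivalent (G : gset3) (K : tri_comp G) (a b : G) : Prop :=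
  exists (f : Hom K a b) (g : Hom K b a),
    equivalent (g ⊗ f) (one1 K a) /\ equivalent (f ⊗ g) (one1 K b).

Section Preservation.
Context {G G' : gset3} (T : tricat_on G) (T' : tricat_on G') (F : gmap3 G G').
Local Notation H := (Hom T).

Definition F1 (a b : G) (f : H a b) : Hom T' (F a) (F b) := mhom F a b f.
Definition F2 (a b : G) (f g : H a b) (α : cell1 f g) : cell1 (F1 f) (F1 g) :=
  m1 (mhom F a b) α.
Definition F3 (a b : G) (f g : H a b) (α β : cell1 f g) (Π : cell2 α β) :
  cell2 (F2 α) (F2 β) := m2 (mhom F a b) Π.

Record preserves_tensor : Prop := PreservesTensor {
  pres_ten0 : forall (a b c : G) (f : H b c) (g : H a b),
    F1 (f ⊗ g) = F1 f ⊗ F1 g;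
  pres_ten1 : forall (a b c : G) (f f' : H b c) (g g' : H a b)
    (α : cell1 f f') (β : cell1 g g'),
    eq1 (F2 (α ⊗₁ β)) (F2 α ⊗₁ F2 β);
  pres_ten2 : forall (a b c : G) (f f' : H b c) (g g' : H a b)
    (α α' : cell1 f f') (β β' : cell1 g g') (Π : cell2 α α') (Λ : cell2 β β'),
    eq2 (F3 (Π ⊗₂ Λ)) (F3 Π ⊗₂ F3 Λ) }.

Record preserves_star : Prop := PreservesStar {
  pres_star1 : forall (a b : G) (f g h : H a b) (α : cell1 g h) (β : cell1 f g),
    F2 (α ∗ β) = F2 α ∗ F2 β;
  pres_star2 : forall (a b : G) (f g h : H a b)
    (α α' : cell1 g h) (β β' : cell1 f g) (Π : cell2 α α') (Λ : cell2 β β'),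
    eq2 (F3 (Π ∗₂ Λ)) (F3 Π ∗₂ F3 Λ) }.

Definition preserves_circ : Prop :=
  forall (a b : G) (f g : H a b) (α β γ : cell1 f g)
    (Π : cell2 β γ) (Λ : cell2 α β), F3 (Π ∘ Λ) = F3 Π ∘ F3 Λ.

Record preserves_units : Prop := PreservesUnits {
  pres_one1 : forall a : G, F1 (one1 T a) = one1 T' (F a);
  pres_id1 : forall (a b : G) (f : H a b), F2 (id1 f) = id1 (F1 f);
  pres_id2 : forall (a b : G) (f g : H a b) (α : cell1 f g),
    F3 (id2 α) = id2 (F2 α) }.

Record preserves_constraints : Prop := PreservesConstraints {
  pres_unit_i : forall a : G, eq1 (F2 (unit_i T a)) (unit_i T' (F a));
  pres_unit_phi : forall a : G, eq2 (F3 (unit_phi T a)) (unit_phi T' (F a));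

  pres_assoc : forall (a b : G) (f g h k : H a b)
    (α : cell1 h k) (β : cell1 g h) (γ : cell1 f g),
    eq2 (F3 (assoc α β γ)) (assoc (F2 α) (F2 β) (F2 γ));
  pres_lunit : forall (a b : G) (f g : H a b) (α : cell1 f g),
    eq2 (F3 (lunit α)) (lunit (F2 α));
  pres_runit : forall (a b : G) (f g : H a b) (α : cell1 f g),
    eq2 (F3 (runit α)) (runit (F2 α));

  pres_phi : forall (a b c : G) (f f' f'' : H b c) (g g' g'' : H a b)
    (α : cell1 f' f'') (β : cell1 g' g'')
    (α' : cell1 f f') (β' : cell1 g g'),
    eq2 (F3 (phi α β α' β')) (phi (F2 α) (F2 β) (F2 α') (F2 β'));
  pres_phi0 : forall (a b c : G) (f : H b c) (g : H a b),
    eq2 (F3 (phi0 f g)) (phi0 (F1 f) (F1 g));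

  pres_a1 : forall (a b c d : G) (h : H c d) (g : H b c) (f : H a b),
    eq1 (F2 (a1 h g f)) (a1 (F1 h) (F1 g) (F1 f));
  pres_aV1 : forall (a b c d : G) (h : H c d) (g : H b c) (f : H a b),
    eq1 (F2 (aV1 h g f)) (aV1 (F1 h) (F1 g) (F1 f));
  pres_a2 : forall (a b c d : G)
    (h h' : H c d) (g g' : H b c) (f f' : H a b)
    (α : cell1 h h') (β : cell1 g g') (γ : cell1 f f'),
    eq2 (F3 (a2 α β γ)) (a2 (F2 α) (F2 β) (F2 γ));
  pres_aV2 : forall (a b c d : G)
    (h h' : H c d) (g g' : H b c) (f f' : H a b)
    (α : cell1 h h') (β : cell1 g g') (γ : cell1 f f'),
    eq2 (F3 (aV2 α β γ)) (aV2 (F2 α) (F2 β) (F2 γ));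
  pres_a_eta : forall (a b c d : G) (h : H c d) (g : H b c) (f : H a b),
    eq2 (F3 (a_eta h g f)) (a_eta (F1 h) (F1 g) (F1 f));
  pres_a_eps : forall (a b c d : G) (h : H c d) (g : H b c) (f : H a b),
    eq2 (F3 (a_eps h g f)) (a_eps (F1 h) (F1 g) (F1 f));

  pres_l1 : forall (a b : G) (f : H a b), eq1 (F2 (l1 f)) (l1 (F1 f));
  pres_lV1 : forall (a b : G) (f : H a b), eq1 (F2 (lV1 f)) (lV1 (F1 f));
  pres_l2 : forall (a b : G) (f f' : H a b) (α : cell1 f f'),
    eq2 (F3 (l2 α)) (l2 (F2 α));
  pres_lV2 : forall (a b : G) (f f' : H a b) (α : cell1 f f'),
    eq2 (F3 (lV2 α)) (lV2 (F2 α));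
  pres_l_eta : forall (a b : G) (f : H a b), eq2 (F3 (l_eta f)) (l_eta (F1 f));
  pres_l_eps : forall (a b : G) (f : H a b), eq2 (F3 (l_eps f)) (l_eps (F1 f));

  pres_r1 : forall (a b : G) (f : H a b), eq1 (F2 (r1 f)) (r1 (F1 f));
  pres_rV1 : forall (a b : G) (f : H a b), eq1 (F2 (rV1 f)) (rV1 (F1 f));
  pres_r2 : forall (a b : G) (f f' : H a b) (α : cell1 f f'),
    eq2 (F3 (r2 α)) (r2 (F2 α));
  pres_rV2 : forall (a b : G) (f f' : H a b) (α : cell1 f f'),
    eq2 (F3 (rV2 α)) (rV2 (F2 α));
  pres_r_eta : forall (a b : G) (f : H a b), eq2 (F3 (r_eta f)) (r_eta (F1 f));
  pres_r_eps : forall (a b : G) (f : H a b), eq2 (F3 (r_eps f)) (r_eps (F1 f));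

  pres_pi : forall (a b c d e : G)
    (k : H d e) (h : H c d) (g : H b c) (f : H a b),
    eq2 (F3 (pi3 k h g f)) (pi3 (F1 k) (F1 h) (F1 g) (F1 f));
  pres_mu : forall (a b c : G) (g : H b c) (f : H a b),
    eq2 (F3 (mu3 g f)) (mu3 (F1 g) (F1 f));
  pres_lambda : forall (a b c : G) (g : H b c) (f : H a b),
    eq2 (F3 (lambda3 g f)) (lambda3 (F1 g) (F1 f));
  pres_rho : forall (a b c : G) (g : H b c) (f : H a b),
    eq2 (F3 (rho3 g f)) (rho3 (F1 g) (F1 f)) }.

Record virtually_strict_functor : Prop := VirtuallyStrictFunctor {
  vs_tensor : preserves_tensor;
  vs_star : preserves_star;
  vs_circ : preserves_circ;
  vs_units : preserves_units;
  vs_constraints : preserves_constraints }.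

Record virtually_strict_triequivalence : Prop := VirtuallyStrictTriequivalence {
  vst_functor : virtually_strict_functor;
  vst_surj : forall a' : G', exists a : G, biequivalent T' (F a) a';
  vst_local_strict : forall a b : G,
    @strict_functor (Hom T a b) (Hom T' (F a) (F b)) (mhom F a b);
  vst_local_biequivalence : forall a b : G,
    @biequivalence2 (Hom T a b) (Hom T' (F a) (F b)) (mhom F a b) }.
End Preservation.

Definition family3 (G : gset3) : Type :=
  forall (a b : G) (f g : hom a b) (α β : cell1 f g), cell2 α β -> Prop.

Section CoherenceSystem.
Context {G : gset3} (T : tricat_on G) (C : family3 G).

Record coherence_3_system : Prop := Coherence3System {
  coh_tensor : forall (a b c : G) (f f' : Hom T b c) (g g' : Hom T a b)
    (α α' : cell1 f f') (β β' : cell1 g g') (Γ : cell2 α α') (Δ : cell2 β β'),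
    C Γ -> C Δ -> C (Γ ⊗₂ Δ);
  coh_star : forall (a b : G) (f g h : Hom T a b)
    (α α' : cell1 g h) (β β' : cell1 f g) (Γ : cell2 α α') (Δ : cell2 β β'),
    C Γ -> C Δ -> C (Γ ∗₂ Δ);
  coh_circ : forall (a b : G) (f g : Hom T a b) (α β γ : cell1 f g)
    (Γ : cell2 β γ) (Δ : cell2 α β), C Γ -> C Δ -> C (Γ ∘ Δ);
  coh_id : forall (a b : G) (f g : Hom T a b) (α : cell1 f g), C (id2 α);
  coh_inv : forall (a b : G) (f g : Hom T a b) (α β : cell1 f g)
    (Γ : cell2 α β), C Γ ->
    exists Δ : cell2 β α, C Δ /\ Δ ∘ Γ = id2 α /\ Γ ∘ Δ = id2 β;
  coh_parallel : forall (a b : G) (f g : Hom T a b) (α β : cell1 f g)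
    (Γ Γ' : cell2 α β), C Γ -> C Γ' -> Γ = Γ' }.
End CoherenceSystem.

Section Quotient.
Context {G : gset3} (T : tricat_on G) (C : family3 G).

Definition sim2 (a b : G) (f g : Hom T a b) (α β : cell1 f g) : Prop :=
  exists Γ : cell2 α β, C Γ.

Record mor3 (a b : G) (f g : Hom T a b) := Mor3 {
  src : cell1 f g;
  tgt : cell1 f g;
  mor : cell2 src tgt }.

Definition sim3 (a b : G) (f g : Hom T a b) (Π Λ : mor3 f g) : Prop :=
  exists (Γ : cell2 (tgt Π) (tgt Λ)) (Γ' : cell2 (src Λ) (src Π)),
    C Γ /\ C Γ' /\ Γ ∘ mor Π ∘ Γ' = mor Λ.

(* Morphisms of the quotient are the equivalence classes themselves, that is,
   the subsets of the form { y | x ~ y }. *)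
Definition quot2 (a b : G) (f g : Hom T a b) : Type :=
  { S : cell1 f g -> Prop | exists α, S = sim2 α }.

Definition class2 (a b : G) (f g : Hom T a b) (α : cell1 f g) : quot2 f g :=
  exist _ (sim2 α) (ex_intro _ α eq_refl).

Definition quot3 (a b : G) (f g : Hom T a b) (x y : quot2 f g) : Type :=
  { S : mor3 f g -> Prop |
    exists Π : mor3 f g, class2 (src Π) = x /\ class2 (tgt Π) = y /\
                         S = sim3 Π }.

Definition class3 (a b : G) (f g : Hom T a b) (α β : cell1 f g)
    (Π : cell2 α β) : quot3 (class2 α) (class2 β) :=
  exist _ (sim3 (Mor3 Π))
    (ex_intro _ (Mor3 Π) (conj eq_refl (conj eq_refl eq_refl))).

Definition quotient : gset3 :=
  GSet3 (obj := obj G)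
    (fun a b => GSet2 (cell0 := cell0 (hom a b)) (cell1 := @quot2 a b)
                  (@quot3 a b)).

Definition quotient_map : gmap3 G quotient :=
  @GMap3 G quotient (fun a => a) (fun a b =>
    @GMap2 (hom a b) (@hom quotient a b) (fun f => f) (@class2 a b)
      (@class3 a b)).
End Quotient.

(* If s[Π] = t[Λ], then [Π] ∘ [Λ] is the class of a composite Π' ∘ Λ' of
   representatives; [Λ] is transported along s[Π] = t[Λ]. *)
Definition circ_on_classes (G : gset3) (T : tricat_on G) (C : family3 G)
    (Q : tricat_on (quotient T C)) : Prop :=
  forall (a b : G) (f g : Hom T a b) (α β γ δ : cell1 f g)
    (Π : cell2 γ δ) (Λ : cell2 α β)
    (e : class2 C β = class2 C γ),
  exists (α' β' γ' : cell1 f g) (Π' : cell2 β' γ') (Λ' : cell2 α' β'),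
    let H := Hom Q a b in
    @eq2 H f g _ _ (class3 C Π') _ _ _ _ (class3 C Π) /\
    @eq2 H f g _ _ (class3 C Λ') _ _ _ _ (class3 C Λ) /\
    @eq2 H f g _ _
      (@vcomp H f g _ _ _ (class3 C Π)
         (eq_rect _ (fun y => @cell2 H f g (class2 C α) y) (class3 C Λ) _ e))
      _ _ _ _ (class3 C (Π' ∘ Λ')).

(* Main.v *)
(** A 2-cell of the quotient is a class of 2-morphisms, and since C contains at
    most one 3-morphism between two given 2-morphisms, a 3-cell of the quotient
    has exactly one representative between any two representatives of its
    boundary.  So every cell of T/C, and every configuration of composable
    cells, lifts to T, and two 3-cells of T/C are equal as soon as they are the
    classes of one 3-morphism of T.  The structure of T is compatible with
    taking classes: for compositions this is closure of C, for the constraint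
    cells it is naturality with respect to the 3-morphisms in C.  All data of a
    tricategory therefore descend to T/C, and each of its equations holds
    because both sides are the classes of the two sides of the same equation in
    T.  Relating cells of T to their classes by a heterogeneous relation,
    rather than by a function, makes the typing of the descended data
    independent of the equations [α ∗ β] = [α] ∗ [β]. *)
From Stdlib Require Import IndefiniteDescription ProofIrrelevance.
From Stdlib Require Import FunctionalExtensionality PropExtensionality.
Require Import Defs.

Set Implicit Arguments.
Unset Strict Implicit.
Unset Printing Implicit Defensive.
Local Open Scope cell_scope.

(** * Choice of witnesses and of dependent functions *)

Definition some (A : Type) (P : A -> Prop) (e : exists x, P x) : A :=
  proj1_sig (constructive_indefinite_description P e).

Lemma someP (A : Type) (P : A -> Prop) (e : exists x, P x) : P (some e).
Proof. exact (proj2_sig (constructive_indefinite_description P e)). Qed.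

(** Descent first yields, for each tuple of quotient cells, the mere existence of a suitable cell;
    the structure records need functions, which this form of choice supplies one argument at a
    time. *)
Lemma dependent_choice (A : Type) (B : A -> Type) (P : forall x, B x -> Prop) :
  (forall x, exists y, P x y) -> exists c : forall x, B x, forall x, P x (c x).
Proof.
intros E.
exists (fun x => some (E x)); intros x; apply someP.
Qed.

Ltac choice_term E :=
  lazymatch type of E with
  | ex _ => constr:(E)
  | forall x : ?A, _ =>
    let E' := constr:(fun x : A =>
      ltac:(let t := choice_term constr:(E x) in exact t)) in
    constr:(dependent_choice E')
  end.

(* Turns [E : forall x .. z, exists c, P] into a choice function [c]. *)
Ltac choose E c cP :=
  let t := choice_term E in
  destruct t as [c cP]; cbv beta in cP; clear E.

(** * Covers of bicategories *)

Section VerticalComposition.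
Variables (B : bicat) (x y : B).

Lemma vcompA (f g h k : cell1 x y) (p : cell2 h k) (n : cell2 g h)
    (m : cell2 f g) : p ∘ n ∘ m = p ∘ (n ∘ m).
Proof. apply vcompA_on. Qed.

Lemma vcompIl (f g : cell1 x y) (m : cell2 f g) : id2 g ∘ m = m.
Proof. apply vcompIl_on. Qed.

Lemma vcompIr (f g : cell1 x y) (m : cell2 f g) : m ∘ id2 f = m.
Proof. apply vcompIr_on. Qed.

(** Inverting two opposite sides of a commuting square. This turns naturality of a constraint cell
    into naturality of its inverse, and later makes conjugacy of 3-morphisms symmetric. *)
Lemma inverse_square (f g f' g' : cell1 x y)
    (m : cell2 f g) (mV : cell2 g f) (n : cell2 f' g') (nV : cell2 g' f')
    (k : cell2 f f') (l : cell2 g g') :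
  m ∘ mV = id2 g -> nV ∘ n = id2 f' -> l ∘ m = n ∘ k -> k ∘ mV = nV ∘ l.
Proof.
intros e1 e2 e; transitivity (nV ∘ (n ∘ k) ∘ mV).
- now rewrite <- vcompA, e2, vcompIl.
- now rewrite <- e, !vcompA, e1, vcompIr.
Qed.
End VerticalComposition.

(* [rel0], [rel1], [rel2] relate a cell to its class, [ker] is the set of
   2-cells in C.  The axioms are chosen to pass to products, since the tensor
   and the constraints live over products of hom bicategories. *)
Record cover (B : bicat) (B' : gset2) := Cover {
  rel0 : B -> B' -> Prop;
  rel1 : forall (x y : B) (x' y' : B'), cell1 x y -> cell1 x' y' -> Prop;
  rel2 : forall (x y : B) (f g : cell1 x y) (x' y' : B') (f' g' : cell1 x' y'),
    cell2 f g -> cell2 f' g' -> Prop;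
  ker : forall (x y : B) (f g : cell1 x y), cell2 f g -> Prop;
  rel1_src : forall (x y : B) (x' y' : B') (f : cell1 x y) (f' : cell1 x' y'),
    rel1 f f' -> rel0 x x';
  rel1_tgt : forall (x y : B) (x' y' : B') (f : cell1 x y) (f' : cell1 x' y'),
    rel1 f f' -> rel0 y y';
  rel2_src : forall (x y : B) (f g : cell1 x y)
    (x' y' : B') (f' g' : cell1 x' y') (m : cell2 f g) (m' : cell2 f' g'),
    rel2 m m' -> rel1 f f';
  rel2_tgt : forall (x y : B) (f g : cell1 x y)
    (x' y' : B') (f' g' : cell1 x' y') (m : cell2 f g) (m' : cell2 f' g'),
    rel2 m m' -> rel1 g g';
  lift0 : forall x' : B', exists x, rel0 x x';
  desc0 : forall x : B, exists x', rel0 x x';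
  rel0_inj : forall (x y : B) (x' : B'), rel0 x x' -> rel0 y x' -> x = y;
  lift1 : forall (x y : B) (x' y' : B') (f' : cell1 x' y'),
    rel0 x x' -> rel0 y y' -> exists f : cell1 x y, rel1 f f';
  desc1 : forall (x y : B) (x' y' : B') (f : cell1 x y),
    rel0 x x' -> rel0 y y' -> exists f' : cell1 x' y', rel1 f f';
  rel1_fun : forall (x y : B) (x' y' : B') (f : cell1 x y) (f' g' : cell1 x' y'),
    rel1 f f' -> rel1 f g' -> f' = g';
  lift2 : forall (x y : B) (f g : cell1 x y)
    (x' y' : B') (f' g' : cell1 x' y') (m' : cell2 f' g'),
    rel1 f f' -> rel1 g g' -> exists m : cell2 f g, rel2 m m';
  desc2 : forall (x y : B) (f g : cell1 x y)
    (x' y' : B') (f' g' : cell1 x' y') (m : cell2 f g),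
    rel1 f f' -> rel1 g g' -> exists m' : cell2 f' g', rel2 m m';
  rel2_fun : forall (x y : B) (f g : cell1 x y)
    (x' y' : B') (f' g' : cell1 x' y') (m : cell2 f g) (m' n' : cell2 f' g'),
    rel2 m m' -> rel2 m n' -> m' = n';
  ker_ex : forall (x y : B) (f g : cell1 x y) (x' y' : B') (h' : cell1 x' y'),
    rel1 f h' -> rel1 g h' -> exists k : cell2 f g, ker k;
  ker_rel1 : forall (x y : B) (f g : cell1 x y) (k : cell2 f g)
    (x' y' : B') (h' : cell1 x' y'), ker k -> rel1 f h' -> rel1 g h';
  rel2_inj : forall (x y : B) (f g f1 g1 : cell1 x y)
    (m : cell2 f g) (n : cell2 f1 g1)
    (x' y' : B') (f' g' : cell1 x' y') (n' : cell2 f' g'),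
    rel2 m n' -> rel2 n n' ->
    exists (k : cell2 f f1) (l : cell2 g g1), ker k /\ ker l /\ l ∘ m = n ∘ k;
  ker_rel2 : forall (x y : B) (f g f1 g1 : cell1 x y)
    (m : cell2 f g) (n : cell2 f1 g1) (k : cell2 f f1) (l : cell2 g g1)
    (x' y' : B') (f' g' : cell1 x' y') (n' : cell2 f' g'),
    ker k -> ker l -> l ∘ m = n ∘ k -> rel2 m n' -> rel2 n n';
  ker_id : forall (x y : B) (f : cell1 x y), ker (id2 f);
  ker_hcomp : forall (x y z : B) (g h : cell1 y z) (f e : cell1 x y)
    (k : cell2 g h) (l : cell2 f e), ker k -> ker l -> ker (k ∗₂ l);
  ker_parallel : forall (x y : B) (f g : cell1 x y) (k l : cell2 f g),
    ker k -> ker l -> k = l }.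

(** Separate from [cover] because the operations on [B'] do not exist at first: [bicat_descent]
    constructs them from a [cover] alone. *)
Record bcover (B B' : bicat) := BCover {
  bcover_cover :> cover B B';
  rel_id1 : forall x x', rel0 bcover_cover x x' ->
    rel1 bcover_cover (id1 x) (id1 x');
  rel_comp1 : forall x y z (g : cell1 y z) (f : cell1 x y)
    x' y' z' (g' : cell1 y' z') (f' : cell1 x' y'),
    rel1 bcover_cover g g' -> rel1 bcover_cover f f' ->
    rel1 bcover_cover (g ∗ f) (g' ∗ f');
  rel_id2 : forall x y (f : cell1 x y) x' y' (f' : cell1 x' y'),
    rel1 bcover_cover f f' -> rel2 bcover_cover (id2 f) (id2 f');
  rel_vcomp : forall x y (f g h : cell1 x y) (n : cell2 g h) (m : cell2 f g)
    x' y' (f' g' h' : cell1 x' y') (n' : cell2 g' h') (m' : cell2 f' g'),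
    rel2 bcover_cover n n' -> rel2 bcover_cover m m' ->
    rel2 bcover_cover (n ∘ m) (n' ∘ m');
  rel_hcomp : forall x y z (g h : cell1 y z) (f e : cell1 x y)
    (n : cell2 g h) (m : cell2 f e)
    x' y' z' (g' h' : cell1 y' z') (f' e' : cell1 x' y')
    (n' : cell2 g' h') (m' : cell2 f' e'),
    rel2 bcover_cover n n' -> rel2 bcover_cover m m' ->
    rel2 bcover_cover (n ∗₂ m) (n' ∗₂ m');
  rel_assoc : forall w x y z (h : cell1 y z) (g : cell1 x y) (f : cell1 w x)
    w' x' y' z' (h' : cell1 y' z') (g' : cell1 x' y') (f' : cell1 w' x'),
    rel1 bcover_cover h h' -> rel1 bcover_cover g g' ->
    rel1 bcover_cover f f' ->
    rel2 bcover_cover (assoc h g f) (assoc h' g' f');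
  rel_assocV : forall w x y z (h : cell1 y z) (g : cell1 x y) (f : cell1 w x)
    w' x' y' z' (h' : cell1 y' z') (g' : cell1 x' y') (f' : cell1 w' x'),
    rel1 bcover_cover h h' -> rel1 bcover_cover g g' ->
    rel1 bcover_cover f f' ->
    rel2 bcover_cover (assocV h g f) (assocV h' g' f');
  rel_lunit : forall x y (f : cell1 x y) x' y' (f' : cell1 x' y'),
    rel1 bcover_cover f f' -> rel2 bcover_cover (lunit f) (lunit f');
  rel_lunitV : forall x y (f : cell1 x y) x' y' (f' : cell1 x' y'),
    rel1 bcover_cover f f' -> rel2 bcover_cover (lunitV f) (lunitV f');
  rel_runit : forall x y (f : cell1 x y) x' y' (f' : cell1 x' y'),
    rel1 bcover_cover f f' -> rel2 bcover_cover (runit f) (runit f');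
  rel_runitV : forall x y (f : cell1 x y) x' y' (f' : cell1 x' y'),
    rel1 bcover_cover f f' -> rel2 bcover_cover (runitV f) (runitV f') }.

(** Every axiom of the quotient is proved through this: its two sides are related to the two sides
    of an equation that already holds upstairs. *)
Lemma rel2_eq (B : bicat) (B' : gset2) (R : cover B B')
    (x y : B) (f g : cell1 x y) (x' y' : B') (f' g' : cell1 x' y')
    (m n : cell2 f g) (m' n' : cell2 f' g') :
  m = n -> rel2 R m m' -> rel2 R n n' -> m' = n'.
Proof. intros <-; apply rel2_fun. Qed.

Create HintDb rel.

(** Relations of boundaries are added to the context, and lifts of the same 0-cell are identified.
    Lifts of the same 1-cell may differ by a cell of [ker] and are left apart. *)
Ltac unify_lifts :=
  repeat match goal with
  | h : rel2 ?R ?m ?m' |- _ =>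
    lazymatch type of m with cell2 ?f ?g =>
    lazymatch type of m' with cell2 ?f' ?g' =>
      lazymatch goal with
      | _ : rel1 R f f', _ : rel1 R g g' |- _ => fail
      | _ => pose proof (rel2_src h); pose proof (rel2_tgt h)
      end end end
  | h : rel1 ?R ?f ?f' |- _ =>
    lazymatch type of f with cell1 ?x ?y =>
    lazymatch type of f' with cell1 ?x' ?y' =>
      lazymatch goal with
      | _ : rel0 R x x', _ : rel0 R y y' |- _ => fail
      | _ => pose proof (rel1_src h); pose proof (rel1_tgt h)
      end end end
  end;
  repeat match goal with
  | h : rel0 ?R ?x ?x', h1 : rel0 ?R ?y ?x' |- _ =>
    first [constr_eq x y; clear h1
          | pose proof (rel0_inj h h1); subst]
  end.

(* The lift of a cell [c'] is named [lc'], and its relation to [c'] is [rc']. *)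
Ltac lift_cells R :=
  repeat match goal with
  | x' : cell0 ?B' |- _ =>
    lazymatch goal with
    | _ : rel0 R _ x' |- _ => fail
    | _ => let x := fresh "l" x' in let h := fresh "r" x' in
           destruct (lift0 R x') as [x h]
    end
  end;
  repeat match goal with
  | f' : cell1 ?x' ?y', hx : rel0 R ?x ?x', hy : rel0 R ?y ?y' |- _ =>
    lazymatch goal with
    | _ : rel1 R _ f' |- _ => fail
    | _ => let f := fresh "l" f' in let h := fresh "r" f' in
           destruct (lift1 f' hx hy) as [f h]
    end
  end;
  repeat match goal with
  | m' : cell2 ?f' ?g', hf : rel1 R ?f ?f', hg : rel1 R ?g ?g' |- _ =>
    lazymatch goal with
    | _ : rel2 R _ m' |- _ => fail
    | _ => let m := fresh "l" m' in let h := fresh "r" m' in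
           destruct (lift2 m' hf hg) as [m h]
    end
  end.

Ltac get_ker :=
  repeat match goal with
  | hf : rel1 ?R ?f ?h, hg : rel1 ?R ?g ?h |- _ =>
    tryif constr_eq f g then fail else
    lazymatch goal with
    | k : cell2 f g |- _ => fail
    | _ => let k := fresh "k" in let h := fresh "hk" in
           destruct (ker_ex hf hg) as [k h]
    end
  end.

#[local] Hint Resolve ker_id ker_hcomp : rel.

Lemma desc1_with (B : bicat) (B' : gset2) (R : cover B B') (x y : B)
    (f : cell1 x y) (x' y' : B') (P : cell1 x' y' -> Prop) :
  rel0 R x x' -> rel0 R y y' -> (forall f', rel1 R f f' -> P f') ->
  exists f', P f'.
Proof. intros hx hy H; destruct (desc1 f hx hy) as [f' r]; eauto. Qed.

Lemma desc2_with (B : bicat) (B' : gset2) (R : cover B B') (x y : B)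
    (f g : cell1 x y) (m : cell2 f g) (x' y' : B') (f' g' : cell1 x' y')
    (P : cell2 f' g' -> Prop) :
  rel1 R f f' -> rel1 R g g' -> (forall m', rel2 R m m' -> P m') ->
  exists m', P m'.
Proof. intros hf hg H; destruct (desc2 m hf hg) as [m' r]; eauto. Qed.

(** The class of [f] is the candidate. If the arguments are lifted differently, the result changes
    along a cell of [ker], so its class stays the same. *)
Ltac descend1 R f :=
  let d := fresh "d" in let r := fresh "r" in
  apply (@desc1_with _ _ R _ _ f);
  [eauto with rel | eauto with rel | intros d r; intros];
  unify_lifts; get_ker; eapply ker_rel1; [| exact r]; eauto with rel.

(* Leaves the naturality square of [m] with respect to [ker]. *)
Ltac descend2 R m :=
  let d := fresh "d" in let r := fresh "r" in
  apply (@desc2_with _ _ R _ _ _ _ m);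
  [eauto with rel | eauto with rel | intros d r; intros];
  unify_lifts; get_ker;
  eapply ker_rel2; [| | | exact r]; [eauto with rel | eauto with rel |].

(** Each operation is computed on lifts and then passed to the class. The assertions [E] include
    independence of the lifts: two choices differ by cells of [ker], with which the operation is
    compatible. The final equation records that the relations of [R] are kept. *)
Lemma bicat_descent (B : bicat) (B' : gset2) (R : cover B B') :
  exists (S : bicat_on B') (RS : bcover B (Bicat S)), bcover_cover RS = R.
Proof.
assert (E : forall x', exists f' : cell1 x' x', forall x, rel0 R x x' ->
  rel1 R (id1 x) f').
{ intros; lift_cells R; descend1 R (id1 lx'). }
choose E i1 i1P.
assert (E : forall x' y' z' (g' : cell1 y' z') (f' : cell1 x' y'),
  exists h' : cell1 x' z', forall x y z (g : cell1 y z) (f : cell1 x y),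
  rel1 R g g' -> rel1 R f f' -> rel1 R (g ∗ f) h').
{ intros; lift_cells R; descend1 R (lg' ∗ lf'). }
choose E c1 c1P.
assert (E : forall x' y' (f' : cell1 x' y'), exists m' : cell2 f' f',
  forall x y (f : cell1 x y), rel1 R f f' -> rel2 R (id2 f) m').
{ intros; lift_cells R; descend2 R (id2 lf').
  now rewrite vcompIl, vcompIr. }
choose E i2 i2P.
assert (E : forall x' y' (f' g' h' : cell1 x' y') (n' : cell2 g' h')
  (m' : cell2 f' g'), exists p' : cell2 f' h',
  forall x y (f g h : cell1 x y) (n : cell2 g h) (m : cell2 f g),
  rel2 R n n' -> rel2 R m m' -> rel2 R (n ∘ m) p').
{ intros; lift_cells R; apply (@desc2_with _ _ R _ _ _ _ (ln' ∘ lm'));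
    [eauto with rel | eauto with rel | intros d r x y f g h n m hn hm].
  unify_lifts.
  destruct (rel2_inj rm' hm) as (k1 & k2 & hk1 & hk2 & e1).
  destruct (rel2_inj rn' hn) as (k3 & k4 & hk3 & hk4 & e2).
  refine (ker_rel2 hk1 hk4 _ r).
  (* Both cells join the same two lifts of [g'], so they are parallel in [ker] and equal; the two
     squares can then be pasted. *)
  rewrite (ker_parallel hk3 hk2) in e2.
  now rewrite <- vcompA, e2, vcompA, e1, <- vcompA. }
choose E c2 c2P.
assert (E : forall x' y' z' (g' h' : cell1 y' z') (f' e' : cell1 x' y')
  (n' : cell2 g' h') (m' : cell2 f' e'),
  exists p' : cell2 (c1 _ _ _ g' f') (c1 _ _ _ h' e'),
  forall x y z (g h : cell1 y z) (f e : cell1 x y) (n : cell2 g h)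
    (m : cell2 f e), rel2 R n n' -> rel2 R m m' -> rel2 R (n ∗₂ m) p').
{ intros; lift_cells R.
  apply (@desc2_with _ _ R _ _ _ _ (ln' ∗₂ lm'));
    [eauto with rel | eauto with rel | intros d r x y z g h f e n m hn hm].
  unify_lifts.
  destruct (rel2_inj rm' hm) as (k1 & k2 & hk1 & hk2 & e1).
  destruct (rel2_inj rn' hn) as (k3 & k4 & hk3 & hk4 & e2).
  (* By interchange the horizontal composite of the two squares is again a commuting square, and its
     sides stay in [ker]. *)
  refine (ker_rel2 (ker_hcomp hk3 hk1) (ker_hcomp hk4 hk2) _ r).
  transitivity ((k4 ∘ ln') ∗₂ (k2 ∘ lm')); [symmetry; apply interchange_on |].
  rewrite e1, e2; apply interchange_on. }
choose E h2 h2P.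
assert (E : forall w' x' y' z' (h' : cell1 y' z') (g' : cell1 x' y')
    (f' : cell1 w' x'),
  exists m' : cell2 (c1 _ _ _ (c1 _ _ _ h' g') f')
                    (c1 _ _ _ h' (c1 _ _ _ g' f')),
  forall w x y z (h : cell1 y z) (g : cell1 x y) (f : cell1 w x),
  rel1 R h h' -> rel1 R g g' -> rel1 R f f' -> rel2 R (assoc h g f) m').
{ intros; lift_cells R; descend2 R (assoc lh' lg' lf').
  symmetry; apply assoc_nat_on. }
choose E a aP.
assert (E : forall w' x' y' z' (h' : cell1 y' z') (g' : cell1 x' y')
    (f' : cell1 w' x'),
  exists m' : cell2 (c1 _ _ _ h' (c1 _ _ _ g' f'))
                    (c1 _ _ _ (c1 _ _ _ h' g') f'),
  forall w x y z (h : cell1 y z) (g : cell1 x y) (f : cell1 w x),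
  rel1 R h h' -> rel1 R g g' -> rel1 R f f' -> rel2 R (assocV h g f) m').
{ intros; lift_cells R; descend2 R (assocV lh' lg' lf').
  eapply inverse_square; [apply assocVK_on | apply assocK_on |].
  symmetry; apply assoc_nat_on. }
choose E aV aVP.
assert (E : forall x' y' (f' : cell1 x' y'),
  exists m' : cell2 (c1 _ _ _ (i1 y') f') f',
  forall x y (f : cell1 x y), rel1 R f f' -> rel2 R (lunit f) m').
{ intros; lift_cells R; descend2 R (lunit lf').
  symmetry; apply lunit_nat_on. }
choose E l lP.
assert (E : forall x' y' (f' : cell1 x' y'),
  exists m' : cell2 f' (c1 _ _ _ (i1 y') f'),
  forall x y (f : cell1 x y), rel1 R f f' -> rel2 R (lunitV f) m').
{ intros; lift_cells R; descend2 R (lunitV lf').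
  eapply inverse_square; [apply lunitVK_on | apply lunitK_on |].
  symmetry; apply lunit_nat_on. }
choose E lV lVP.
assert (E : forall x' y' (f' : cell1 x' y'),
  exists m' : cell2 (c1 _ _ _ f' (i1 x')) f',
  forall x y (f : cell1 x y), rel1 R f f' -> rel2 R (runit f) m').
{ intros; lift_cells R; descend2 R (runit lf').
  symmetry; apply runit_nat_on. }
choose E r rP.
assert (E : forall x' y' (f' : cell1 x' y'),
  exists m' : cell2 f' (c1 _ _ _ f' (i1 x')),
  forall x y (f : cell1 x y), rel1 R f f' -> rel2 R (runitV f) m').
{ intros; lift_cells R; descend2 R (runitV lf').
  eapply inverse_square; [apply runitVK_on | apply runitK_on |].
  symmetry; apply runit_nat_on. }
choose E rV rVP.
unshelve (refine (let S := @BicatOn B' i1 c1 i2 c2 h2 a aV l lV r rV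
  _ _ _ _ _ _ _ _ _ _ _ _ _ _ _ _ in _)).
17: {
  assert (RS : exists RS : bcover B (Bicat S), bcover_cover RS = R).
  { unshelve (refine (ex_intro _ (@BCover B (Bicat S) R
      _ _ _ _ _ _ _ _ _ _ _) eq_refl)); intros.
    - now apply i1P.
    - now apply c1P.
    - now apply i2P.
    - now apply (@c2P _ _ f' g' h').
    - now apply (@h2P _ _ _ g' h' f' e').
    - now apply aP.
    - now apply aVP.
    - now apply lP.
    - now apply lVP.
    - now apply rP.
    - now apply rVP. }
  exists S; exact RS. }
(* The axioms of [S]: once all cells are lifted, both sides are related to the sides of the same
   axiom in [B]. *)
all: intros; lift_cells R;
  (eapply (rel2_eq (R := R));
    [| solve [eauto 100 with rel] | solve [eauto 20 with rel]]).
- apply vcompA_on.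
- apply vcompIl_on.
- apply vcompIr_on.
- apply hcompI_on.
- apply interchange_on.
- apply assoc_nat_on.
- apply lunit_nat_on.
- apply runit_nat_on.
- apply assocK_on.
- apply assocVK_on.
- apply lunitK_on.
- apply lunitVK_on.
- apply runitK_on.
- apply runitVK_on.
- apply pentagon_on.
- apply triangle_on.
Qed.

#[local] Hint Resolve rel_id1 rel_comp1 rel_id2 rel_vcomp rel_hcomp rel_assoc
  rel_assocV rel_lunit rel_lunitV rel_runit rel_runitV : rel.

(** * Descent of functors, transformations and modifications *)

Section Relations.
Variables (B B' C C' : bicat) (R : bcover B B') (S : bcover C C').

(** The field [ker_f2] belongs here because a naturality square along a cell of [ker] has images of
    that cell in its sides, and these must again lie in [ker] for transformations to descend. *)
Record rel_fun (F : fdata B C) (F' : fdata B' C') : Prop := RelFun {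
  rel_f0 : forall x x', rel0 R x x' -> rel0 S (F x) (F' x');
  rel_f1 : forall x y (f : cell1 x y) x' y' (f' : cell1 x' y'),
    rel1 R f f' -> rel1 S (f1 F f) (f1 F' f');
  rel_f2 : forall x y (f g : cell1 x y) (m : cell2 f g)
    x' y' (f' g' : cell1 x' y') (m' : cell2 f' g'),
    rel2 R m m' -> rel2 S (f2 F m) (f2 F' m');
  rel_fcomp : forall x y z (g : cell1 y z) (f : cell1 x y)
    x' y' z' (g' : cell1 y' z') (f' : cell1 x' y'),
    rel1 R g g' -> rel1 R f f' -> rel2 S (fcomp F g f) (fcomp F' g' f');
  rel_fid : forall x x', rel0 R x x' -> rel2 S (fid F x) (fid F' x');
  ker_f2 : forall x y (f g : cell1 x y) (k : cell2 f g),
    ker R k -> ker S (f2 F k) }.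

Record rel_pfun (F : pfun B C) (F' : pfun B' C') : Prop := RelPFun {
  rel_pfun_fun :> rel_fun F F';
  rel_fcompV : forall x y z (g : cell1 y z) (f : cell1 x y)
    x' y' z' (g' : cell1 y' z') (f' : cell1 x' y'),
    rel1 R g g' -> rel1 R f f' -> rel2 S (fcompV F g f) (fcompV F' g' f');
  rel_fidV : forall x x', rel0 R x x' -> rel2 S (fidV F x) (fidV F' x') }.

Section Transformations.
Variables (F G : fdata B C) (F' G' : fdata B' C').

Record rel_tdata (t : tdata F G) (t' : tdata F' G') : Prop := RelTData {
  rel_tc : forall x x', rel0 R x x' -> rel1 S (t x) (t' x');
  rel_tn : forall x y (f : cell1 x y) x' y' (f' : cell1 x' y'),
    rel1 R f f' -> rel2 S (tn t f) (tn t' f') }.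

Record rel_trans (t : trans F G) (t' : trans F' G') : Prop := RelTrans {
  rel_trans_tdata :> rel_tdata t t';
  rel_tnV : forall x y (f : cell1 x y) x' y' (f' : cell1 x' y'),
    rel1 R f f' -> rel2 S (tnV t f) (tnV t' f') }.

Record rel_modif (t s : tdata F G) (t' s' : tdata F' G')
    (M : inv_modif t s) (M' : inv_modif t' s') : Prop := RelModif {
  rel_mc : forall x x', rel0 R x x' -> rel2 S (M x) (M' x');
  rel_mcV : forall x x', rel0 R x x' -> rel2 S (mcV M x) (mcV M' x') }.
End Transformations.

Record rel_adjeqv (F G : fdata B C) (F' G' : fdata B' C')
    (A : adjeqv F G) (A' : adjeqv F' G') : Prop := RelAdjEqv {
  rel_fwd : rel_trans (fwd A) (fwd A');
  rel_bwd : rel_trans (bwd A) (bwd A');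
  rel_aunit : rel_modif (aunit A) (aunit A');
  rel_acounit : rel_modif (acounit A) (acounit A') }.
End Relations.

#[local] Hint Resolve rel_f0 rel_f1 rel_f2 rel_fcomp rel_fid ker_f2
  rel_fcompV rel_fidV rel_pfun_fun rel_tc rel_tn rel_tnV rel_trans_tdata
  rel_mc rel_mcV : rel.

(* Redefined whenever relatedness of further operations has been proved. *)
Ltac rel_extension := fail.

(** The search is directed by the head of the quotient cell; the cell upstairs is matched by
    unification. *)
Ltac rel_step :=
  lazymatch goal with
  | |- rel2 (bcover_cover ?R) _ (_ ∘ _) => eapply (@rel_vcomp _ _ R)
  | |- rel2 (bcover_cover ?R) _ (_ ∗₂ _) => eapply (@rel_hcomp _ _ R)
  | |- rel2 (bcover_cover ?R) _ (id2 _) => eapply (@rel_id2 _ _ R)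
  | |- rel2 (bcover_cover ?R) _ (assoc _ _ _) => eapply (@rel_assoc _ _ R)
  | |- rel2 (bcover_cover ?R) _ (assocV _ _ _) => eapply (@rel_assocV _ _ R)
  | |- rel2 (bcover_cover ?R) _ (lunit _) => eapply (@rel_lunit _ _ R)
  | |- rel2 (bcover_cover ?R) _ (lunitV _) => eapply (@rel_lunitV _ _ R)
  | |- rel2 (bcover_cover ?R) _ (runit _) => eapply (@rel_runit _ _ R)
  | |- rel2 (bcover_cover ?R) _ (runitV _) => eapply (@rel_runitV _ _ R)
  | |- rel2 _ _ (f2 _ _) => eapply rel_f2
  | |- rel2 _ _ (fcomp _ _ _) => eapply rel_fcomp
  | |- rel2 _ _ (fid _ _) => eapply rel_fid
  | |- rel2 _ _ (fcompV _ _ _) => eapply rel_fcompV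
  | |- rel2 _ _ (fidV _ _) => eapply rel_fidV
  | |- rel2 _ _ (tn _ _) => eapply rel_tn
  | |- rel2 _ _ (tnV _ _) => eapply rel_tnV
  | h : rel_modif _ _ _ ?M |- rel2 _ _ (mc ?M _) => eapply (rel_mc h)
  | |- rel1 (bcover_cover ?R) _ (id1 _) => eapply (@rel_id1 _ _ R)
  | |- rel1 (bcover_cover ?R) _ (_ ∗ _) => eapply (@rel_comp1 _ _ R)
  | |- rel1 _ _ (f1 _ _) => eapply rel_f1
  | |- rel1 _ _ (tc _ _) => eapply rel_tc
  | |- rel0 _ _ (f0 _ _) => eapply rel_f0
  | |- _ => first [rel_extension | solve [eauto with rel]]
  end.

Ltac rel := repeat first [eassumption | rel_step].

Section Descent.
Variables (B B' C C' : bicat) (R : bcover B B') (S : bcover C C').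

(** Preservation of [ker] makes the action on 1- and 2-cells well defined on classes; the comparison
    cells for composites descend by their naturality, those for identities because 0-cells have
    unique lifts. *)
Lemma pfun_descent (F : pfun B C)
    (hF : forall x y (f g : cell1 x y) (k : cell2 f g),
      ker R k -> ker S (f2 F k)) :
  exists F' : pfun B' C', rel_pfun R S F F'.
Proof.
assert (E : forall x', exists y', forall x, rel0 R x x' -> rel0 S (F x) y').
{ intros; lift_cells (bcover_cover R); destruct (desc0 S (F lx')) as [y' ry].
  exists y'; intros; now unify_lifts. }
choose E p0 p0P.
assert (E : forall x' y' (f' : cell1 x' y'), exists h' : cell1 (p0 x') (p0 y'),
  forall x y (f : cell1 x y), rel1 R f f' -> rel1 S (f1 F f) h').
{ intros; lift_cells (bcover_cover R); descend1 S (f1 F lf'). }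
choose E p1 p1P.
assert (E : forall x' y' (f' g' : cell1 x' y') (m' : cell2 f' g'),
  exists n' : cell2 (p1 _ _ f') (p1 _ _ g'),
  forall x y (f g : cell1 x y) (m : cell2 f g),
  rel2 R m m' -> rel2 S (f2 F m) n').
{ intros; lift_cells (bcover_cover R).
  apply (@desc2_with _ _ S _ _ _ _ (f2 F lm'));
    [eauto with rel | eauto with rel | intros d r x y f g m hm].
  unify_lifts; destruct (rel2_inj rm' hm) as (k & l & hk & hl & e).
  (* By functoriality [F] maps the square connecting two lifts of [m'] to a square of the same
     kind. *)
  refine (ker_rel2 (hF _ _ _ _ _ hk) (hF _ _ _ _ _ hl) _ r).
  now rewrite <- !f2_vcomp, e. }
choose E p2 p2P.
assert (E : forall x' y' z' (g' : cell1 y' z') (f' : cell1 x' y'),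
  exists m' : cell2 (p1 _ _ g' ∗ p1 _ _ f') (p1 _ _ (g' ∗ f')),
  forall x y z (g : cell1 y z) (f : cell1 x y),
  rel1 R g g' -> rel1 R f f' -> rel2 S (fcomp F g f) m').
{ intros; lift_cells (bcover_cover R); descend2 S (fcomp F lg' lf').
  symmetry; apply fcomp_nat. }
choose E pc pcP.
assert (E : forall x' y' z' (g' : cell1 y' z') (f' : cell1 x' y'),
  exists m' : cell2 (p1 _ _ (g' ∗ f')) (p1 _ _ g' ∗ p1 _ _ f'),
  forall x y z (g : cell1 y z) (f : cell1 x y),
  rel1 R g g' -> rel1 R f f' -> rel2 S (fcompV F g f) m').
{ intros; lift_cells (bcover_cover R); descend2 S (fcompV F lg' lf').
  eapply inverse_square; [apply fcompVK | apply fcompK |].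
  symmetry; apply fcomp_nat. }
choose E pcV pcVP.
assert (E : forall x', exists m' : cell2 (id1 (p0 x')) (p1 _ _ (id1 x')),
  forall x, rel0 R x x' -> rel2 S (fid F x) m').
{ intros; lift_cells (bcover_cover R).
  (* A 0-cell has a single lift by [rel0_inj], so there is no second choice to compare. *)
  apply (@desc2_with _ _ S _ _ _ _ (fid F lx'));
    [eauto with rel | eauto with rel | intros; now unify_lifts]. }
choose E pi0 pi0P.
assert (E : forall x', exists m' : cell2 (p1 _ _ (id1 x')) (id1 (p0 x')),
  forall x, rel0 R x x' -> rel2 S (fidV F x) m').
{ intros; lift_cells (bcover_cover R).
  apply (@desc2_with _ _ S _ _ _ _ (fidV F lx'));
    [eauto with rel | eauto with rel | intros; now unify_lifts]. }
choose E piV piVP.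
pose (D := @FData B' C' p0 p1 p2 pc pi0).
assert (rD : rel_fun R S F D) by (split; eauto).
unshelve (refine (let F' := @PFun B' C' D pcV piV
  _ _ _ _ _ _ _ _ _ _ in _)).
11: { exists F'; split; [exact rD | eauto | eauto]. }
all: intros; lift_cells (bcover_cover R);
  (eapply (rel2_eq (R := S));
    [| solve [rel] | solve [rel]]).
- apply f2_id.
- apply f2_vcomp.
- apply fcomp_nat.
- apply fcompK.
- apply fcompVK.
- apply fidK.
- apply fidVK.
- apply fcomp_assoc.
- apply fid_l.
- apply fid_r.
Qed.

Section Transformations.
Variables (F G : fdata B C) (F' G' : fdata B' C').
Hypotheses (rF : rel_fun R S F F') (rG : rel_fun R S G G').

(** The components sit over 0-cells, which lift uniquely; the naturality cells descend because
    [tn_nat] applies to the cells of [ker] between two lifts of a 1-cell. *)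
Lemma trans_descent (t : trans F G) :
  exists t' : trans F' G', rel_trans R S t t'.
Proof.
assert (E : forall x', exists h' : cell1 (F' x') (G' x'),
  forall x, rel0 R x x' -> rel1 S (t x) h').
{ intros; lift_cells (bcover_cover R); descend1 S (t lx'). }
choose E c cP.
assert (E : forall x' y' (f' : cell1 x' y'),
  exists m' : cell2 (f1 G' f' ∗ c x') (c y' ∗ f1 F' f'),
  forall x y (f : cell1 x y), rel1 R f f' -> rel2 S (tn t f) m').
{ intros; lift_cells (bcover_cover R); descend2 S (tn t lf').
  symmetry; apply tn_nat. }
choose E n nP.
assert (E : forall x' y' (f' : cell1 x' y'),
  exists m' : cell2 (c y' ∗ f1 F' f') (f1 G' f' ∗ c x'),
  forall x y (f : cell1 x y), rel1 R f f' -> rel2 S (tnV t f) m').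
{ intros; lift_cells (bcover_cover R); descend2 S (tnV t lf').
  eapply inverse_square; [apply tnVK | apply tnK |].
  symmetry; apply tn_nat. }
choose E nV nVP.
pose (D := @TData B' C' F' G' c n).
assert (rD : rel_tdata R S t D) by (split; eauto).
unshelve (refine (let t' := @Trans B' C' F' G' D nV _ _ _ _ _ in _)).
6: { exists t'; split; [exact rD | eauto]. }
all: intros; lift_cells (bcover_cover R);
  (eapply (rel2_eq (R := S));
    [| solve [rel] | solve [rel]]).
- apply tnK.
- apply tnVK.
- apply tn_nat.
- apply tn_comp.
- apply tn_id.
Qed.

(** The boundaries [t'] and [s'] are arbitrary related data rather than descended transformations,
    so that units, counits and modifications between pasted composites are all covered. *)
Lemma modif_descent (t s : tdata F G) (t' s' : tdata F' G')
    (rt : rel_tdata R S t t') (rs : rel_tdata R S s s') (M : inv_modif t s) :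
  exists M' : inv_modif t' s', rel_modif R S M M'.
Proof.
assert (E : forall x', exists m' : cell2 (t' x') (s' x'),
  forall x, rel0 R x x' -> rel2 S (M x) m').
{ intros; lift_cells (bcover_cover R).
  apply (@desc2_with _ _ S _ _ _ _ (M lx'));
    [eauto with rel | eauto with rel | intros; now unify_lifts]. }
choose E c cP.
assert (E : forall x', exists m' : cell2 (s' x') (t' x'),
  forall x, rel0 R x x' -> rel2 S (mcV M x) m').
{ intros; lift_cells (bcover_cover R).
  apply (@desc2_with _ _ S _ _ _ _ (mcV M lx'));
    [eauto with rel | eauto with rel | intros; now unify_lifts]. }
choose E cV cVP.
unshelve (refine (let M' := @InvModif B' C' F' G' t' s' c cV _ _ _ in _)).
4: { exists M'; split; eauto. }
all: intros; lift_cells (bcover_cover R);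
  (eapply (rel2_eq (R := S));
    [| solve [rel] | solve [rel]]).
- apply mcK.
- apply mcVK.
- apply mc_nat.
Qed.
End Transformations.

Lemma rel_tident (F : fdata B C) (F' : fdata B' C') :
  rel_fun R S F F' -> rel_tdata R S (tident F) (tident F').
Proof. intros; split; cbn; intros; unify_lifts; rel. Qed.

Lemma rel_tcompose (F G H : fdata B C) (F' G' H' : fdata B' C')
    (s : tdata G H) (t : tdata F G) (s' : tdata G' H') (t' : tdata F' G') :
  rel_fun R S F F' -> rel_fun R S G G' -> rel_fun R S H H' ->
  rel_tdata R S s s' -> rel_tdata R S t t' ->
  rel_tdata R S (s • t) (s' • t').
Proof. intros; split; cbn; intros; unify_lifts; rel. Qed.
#[local] Hint Resolve rel_tident rel_tcompose : rel.

(** The two transformations descend first; their composites, together with the identities, are the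
    boundaries over which the unit and counit descend. *)
Lemma adjeqv_descent (F G : fdata B C) (F' G' : fdata B' C')
    (rF : rel_fun R S F F') (rG : rel_fun R S G G') (A : adjeqv F G) :
  exists A' : adjeqv F' G', rel_adjeqv R S A A'.
Proof.
destruct (trans_descent rF rG (fwd A)) as [t rt].
destruct (trans_descent rG rF (bwd A)) as [s rs].
assert (ru : rel_tdata R S (tident F) (tident F')) by rel.
assert (rst : rel_tdata R S (bwd A • fwd A) (s • t)) by rel.
destruct (modif_descent rF rF ru rst (aunit A)) as [u hu].
assert (rts : rel_tdata R S (fwd A • bwd A) (t • s)) by rel.
assert (rv : rel_tdata R S (tident G) (tident G')) by rel.
destruct (modif_descent rG rG rts rv (acounit A)) as [v hv].
unshelve (refine (let A' := @AdjEqv B' C' F' G' t s u v _ _ in _)).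
3: { exists A'; split; assumption. }
all: intros; lift_cells (bcover_cover R);
  (eapply (rel2_eq (R := S));
    [| solve [rel] | solve [rel]]).
- apply triangle_fwd.
- apply triangle_bwd.
Qed.
End Descent.

(** * Products of covers and the cover of the terminal bicategory *)

Section Product.
Variables (B B' C C' : bicat) (R : bcover B B') (S : bcover C C').

(** Transparent, so that relatedness of tuples unfolds to the conjunction of the relations of their
    entries. *)
Definition prod_cover : cover (B × C) (B' × C').
Proof.
unshelve (refine (@Cover (B × C) (B' × C')
  (fun x x' => rel0 R (fst x) (fst x') /\ rel0 S (snd x) (snd x'))
  (fun _ _ _ _ f f' => rel1 R (fst f) (fst f') /\ rel1 S (snd f) (snd f'))
  (fun _ _ _ _ _ _ _ _ m m' =>
     rel2 R (fst m) (fst m') /\ rel2 S (snd m) (snd m'))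
  (fun _ _ _ _ k => ker R (fst k) /\ ker S (snd k))
  _ _ _ _ _ _ _ _ _ _ _ _ _ _ _ _ _ _ _ _)); cbn.
- intros x y x' y' f f' [h k]; split; eapply rel1_src; eassumption.
- intros x y x' y' f f' [h k]; split; eapply rel1_tgt; eassumption.
- intros x y f g x' y' f' g' m m' [h k]; split; eapply rel2_src; eassumption.
- intros x y f g x' y' f' g' m m' [h k]; split; eapply rel2_tgt; eassumption.
- intros [x' y']; destruct (lift0 R x') as [x hx], (lift0 S y') as [y hy].
  now exists (x, y).
- intros [x y]; destruct (desc0 R x) as [x' hx], (desc0 S y) as [y' hy].
  now exists (x', y').
- intros [x1 x2] [y1 y2] x' [h1 h2] [k1 k2]; cbn in *.
  now rewrite (rel0_inj h1 k1), (rel0_inj h2 k2).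
- intros x y x' y' [f' g'] [h1 h2] [k1 k2].
  destruct (lift1 f' h1 k1) as [f hf], (lift1 g' h2 k2) as [g hg].
  now exists (f, g).
- intros x y x' y' [f g] [h1 h2] [k1 k2].
  destruct (desc1 f h1 k1) as [f' hf], (desc1 g h2 k2) as [g' hg].
  now exists (f', g').
- intros x y x' y' f [f1 f2] [g1 g2] [h1 h2] [k1 k2]; cbn in *.
  now rewrite (rel1_fun h1 k1), (rel1_fun h2 k2).
- intros x y f g x' y' f' g' [m' n'] [h1 h2] [k1 k2].
  destruct (lift2 m' h1 k1) as [m hm], (lift2 n' h2 k2) as [n hn].
  now exists (m, n).
- intros x y f g x' y' f' g' [m n] [h1 h2] [k1 k2].
  destruct (desc2 m h1 k1) as [m' hm], (desc2 n h2 k2) as [n' hn].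
  now exists (m', n').
- intros x y f g x' y' f' g' m [m1 m2] [n1 n2] [h1 h2] [k1 k2]; cbn in *.
  now rewrite (rel2_fun h1 k1), (rel2_fun h2 k2).
- intros x y f g x' y' h' [h1 h2] [k1 k2].
  destruct (ker_ex h1 k1) as [k hk], (ker_ex h2 k2) as [l hl].
  now exists (k, l).
- intros x y f g k x' y' h' [k1 k2] [h1 h2].
  split; eapply ker_rel1; eassumption.
- intros x y f g p q m n x' y' f' g' n' [h1 h2] [k1 k2].
  destruct (rel2_inj h1 k1) as (k & l & hk & hl & e).
  destruct (rel2_inj h2 k2) as (k' & l' & hk' & hl' & e').
  exists (k, k'), (l, l'); repeat split; try assumption.
  exact (f_equal2 pair e e').
- intros x y f g p q m n k l x' y' f' g' n' [k1 k2] [l1 l2] e [h1 h2].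
  split; [refine (ker_rel2 k1 l1 _ h1) | refine (ker_rel2 k2 l2 _ h2)].
  + exact (f_equal fst e).
  + exact (f_equal snd e).
- intros; split; apply ker_id.
- intros x y z g h f e k l [k1 k2] [l1 l2]; split; now apply ker_hcomp.
- intros x y f g [k1 k2] [l1 l2] [h1 h2] [h3 h4]; cbn in *.
  now rewrite (ker_parallel h1 h3), (ker_parallel h2 h4).
Defined.

Definition prod_bcover : bcover (B × C) (B' × C').
Proof.
unshelve (refine (@BCover (B × C) (B' × C') prod_cover
  _ _ _ _ _ _ _ _ _ _ _)); cbn; intros;
  repeat match goal with h : _ /\ _ |- _ => destruct h end;
  split; rel.
Defined.

End Product.

(** The unit functors upstairs and downstairs start at the same terminal bicategory, which covers
    itself by the total relations. *)
Definition one_cover : cover one_bicat one_bicat.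
Proof.
refine (@Cover one_bicat one_bicat (fun _ _ => True) (fun _ _ _ _ _ _ => True)
  (fun _ _ _ _ _ _ _ _ _ _ => True) (fun _ _ _ _ _ => True)
  _ _ _ _ _ _ _ _ _ _ _ _ _ _ _ _ _ _ _ _);
  intros; cbn;
  repeat match goal with u : unit |- _ => destruct u end;
  try (exists tt); auto.
- now destruct x, y.
- now destruct f', g'.
- now destruct m', n'.
- exists tt; auto.
- now destruct k, l.
Defined.

Definition one_bcover : bcover one_bicat one_bicat.
Proof.
refine (@BCover one_bicat one_bicat one_cover _ _ _ _ _ _ _ _ _ _ _);
  intros; exact I.
Defined.

(** * Relatedness of identities, composites, projections and pairings of functors *)

Section FunctorRelations.
Variables (B B' C C' D D' : bicat).
Variables (R : bcover B B') (S : bcover C C') (T : bcover D D').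

Lemma rel_fident : rel_fun R R (fident B) (fident B').
Proof. split; cbn; intros; rel. Qed.

Lemma rel_fcompose (G : fdata C D) (G' : fdata C' D')
    (F : fdata B C) (F' : fdata B' C') :
  rel_fun S T G G' -> rel_fun R S F F' ->
  rel_fun R T (fcompose G F) (fcompose G' F').
Proof. split; cbn; intros; rel. Qed.

Lemma rel_ffst : rel_fun (prod_bcover R S) R (ffst B C) (ffst B' C').
Proof.
split; cbn; intros;
  repeat match goal with h : _ /\ _ |- _ => destruct h end; rel.
Qed.

Lemma rel_fsnd : rel_fun (prod_bcover R S) S (fsnd B C) (fsnd B' C').
Proof.
split; cbn; intros;
  repeat match goal with h : _ /\ _ |- _ => destruct h end; rel.
Qed.

Lemma rel_fpair (P : fdata B C) (P' : fdata B' C')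
    (Q : fdata B D) (Q' : fdata B' D') :
  rel_fun R S P P' -> rel_fun R T Q Q' ->
  rel_fun R (prod_bcover S T) (fpair P Q) (fpair P' Q').
Proof. split; cbn; intros; split; rel. Qed.

Lemma rel_fbang : rel_fun R one_bcover (fbang B) (fbang B').
Proof. split; cbn; auto. Qed.
End FunctorRelations.

Ltac rel_functor_step :=
  lazymatch goal with
  | |- rel_fun _ _ _ (fident _) => apply rel_fident
  | |- rel_fun _ _ _ (fcompose _ _) => eapply rel_fcompose
  | |- rel_fun _ _ _ (ffst _ _) => apply rel_ffst
  | |- rel_fun _ _ _ (fsnd _ _) => apply rel_fsnd
  | |- rel_tdata _ _ _ (tident _) => apply rel_tident
  | |- rel_tdata _ _ _ (_ • _) => eapply rel_tcompose
  end.

Ltac rel_extension ::= rel_functor_step.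

(** * Descent of tricategories *)

Section TricategoryRelations.
Variables (G : gset3) (H' : G -> G -> gset2).
(** Passing to the quotient keeps the objects, so covers are indexed by pairs of objects of [G]. *)
Let G' : gset3 := GSet3 H'.

Record tri_comp_cover (K : tri_comp G) (K' : tri_comp G') := TriCompCover {
  hom_cover : forall a b : G, bcover (Hom K a b) (@Hom G' K' a b);
  rel_tensor : forall a b c : G,
    rel_pfun (prod_bcover (hom_cover b c) (hom_cover a b)) (hom_cover a c)
      (tensor K a b c) (@tensor G' K' a b c);
  rel_tunit : forall a : G,
    rel_pfun one_bcover (hom_cover a a) (tunit K a) (@tunit G' K' a) }.

(** Closure of [ker] under the tensor is what [pfun_descent] asks of the functor [tensor]. The
    conclusion remembers the given covers, so that they can be identified at the end. *)
Lemma tri_comp_descent (K : tri_comp G)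
    (R : forall a b, cover (Hom K a b) (H' a b)) :
  (forall (a b c : G) (f f' : Hom K b c) (g g' : Hom K a b)
    (α α' : cell1 f f') (β β' : cell1 g g') (k : cell2 α α') (l : cell2 β β'),
    ker (R b c) k -> ker (R a b) l -> ker (R a c) (k ⊗₂ l)) ->
  exists (K' : tri_comp G') (RK : tri_comp_cover K K'),
    forall a b, bcover_cover (hom_cover RK a b) = R a b.
Proof.
intros hR.
(* Structure and cover are packed in one pair, so that a single choice selects both. *)
assert (E : forall a b,
  exists S : {S : bicat_on (H' a b) & bcover (Hom K a b) (Bicat S)},
    bcover_cover (projT2 S) = R a b).
{ intros a b; destruct (bicat_descent (R a b)) as (S & RS & e).
  now exists (existT _ S RS). }
choose E s sP.
assert (E : forall a b c, exists F : pfun (Bicat (projT1 (s b c)) ×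
    Bicat (projT1 (s a b))) (Bicat (projT1 (s a c))),
  rel_pfun (prod_bcover (projT2 (s b c)) (projT2 (s a b))) (projT2 (s a c))
    (tensor K a b c) F).
{ intros a b c; apply pfun_descent.
  intros [f f'] [g g'] [α α'] [β β'] [k l] [hk hl]; cbn in *.
  rewrite sP in *; now apply hR. }
choose E ten tenP.
assert (E : forall a, exists F : pfun one_bicat (Bicat (projT1 (s a a))),
  rel_pfun one_bcover (projT2 (s a a)) (tunit K a) F).
{ intros a; apply pfun_descent; intros [] [] [] [] [] _.
  (* The only 2-cell of the terminal bicategory is an identity, so its image is an identity and lies
     in [ker]. *)
  change (ker (bcover_cover (projT2 (s a a)))
    (f2 (tunit K a) (@id2 one_bicat tt tt tt))).
  rewrite f2_id; apply ker_id. }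
choose E one oneP.
exists (@TriComp G' (fun a b => projT1 (s a b)) ten one).
now exists (@TriCompCover K (@TriComp G' (fun a b => projT1 (s a b)) ten one)
  (fun a b => projT2 (s a b)) tenP oneP).
Qed.

Section Composition.
Variables (K : tri_comp G) (K' : tri_comp G') (RK : tri_comp_cover K K').
Local Notation R := (hom_cover RK).

Section Tensor.
Variables a b c : G.

Lemma rel_ten0 (f : Hom K b c) (g : Hom K a b)
    (f' : @Hom G' K' b c) (g' : @Hom G' K' a b) :
  rel0 (R b c) f f' -> rel0 (R a b) g g' ->
  rel0 (R a c) (f ⊗ g) (f' ⊗ g').
Proof.
intros hf hg; apply (rel_f0 (rel_tensor RK a b c)); now split.
Qed.

Lemma rel_ten1 (f f1 : Hom K b c) (g g1 : Hom K a b)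
    (α : cell1 f f1) (β : cell1 g g1)
    (f' f1' : @Hom G' K' b c) (g' g1' : @Hom G' K' a b)
    (α' : cell1 f' f1') (β' : cell1 g' g1') :
  rel1 (R b c) α α' -> rel1 (R a b) β β' ->
  rel1 (R a c) (α ⊗₁ β) (α' ⊗₁ β').
Proof.
intros hf hg; apply (rel_f1 (rel_tensor RK a b c)); now split.
Qed.

Lemma rel_ten2 (f f1 : Hom K b c) (g g1 : Hom K a b)
    (α α1 : cell1 f f1) (β β1 : cell1 g g1)
    (m : cell2 α α1) (n : cell2 β β1)
    (f' f1' : @Hom G' K' b c) (g' g1' : @Hom G' K' a b)
    (α' α1' : cell1 f' f1') (β' β1' : cell1 g' g1')
    (m' : cell2 α' α1') (n' : cell2 β' β1') :
  rel2 (R b c) m m' -> rel2 (R a b) n n' ->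
  rel2 (R a c) (m ⊗₂ n) (m' ⊗₂ n').
Proof.
intros hf hg; apply (rel_f2 (rel_tensor RK a b c)); now split.
Qed.

Section Interchangers.
Variables (f p q : Hom K b c) (g r s : Hom K a b).
Variables (α : cell1 p q) (β : cell1 r s) (γ : cell1 f p) (δ : cell1 g r).
Variables (f' p' q' : @Hom G' K' b c) (g' r' s' : @Hom G' K' a b).
Variables (α' : cell1 p' q') (β' : cell1 r' s').
Variables (γ' : cell1 f' p') (δ' : cell1 g' r').
Hypotheses (hα : rel1 (R b c) α α') (hβ : rel1 (R a b) β β').
Hypotheses (hγ : rel1 (R b c) γ γ') (hδ : rel1 (R a b) δ δ').

Lemma rel_phi : rel2 (R a c) (phi α β γ δ) (phi α' β' γ' δ').
Proof. apply (rel_fcomp (rel_tensor RK a b c)); now split. Qed.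

Lemma rel_phiV : rel2 (R a c) (phiV α β γ δ) (phiV α' β' γ' δ').
Proof.
exact (@rel_fcompV _ _ _ _ _ _ _ _ (rel_tensor RK a b c)
  (f, g) (p, r) (q, s) (α, β) (γ, δ) (f', g') (p', r') (q', s')
  (α', β') (γ', δ') (conj hα hβ) (conj hγ hδ)).
Qed.
End Interchangers.

Lemma rel_phi0 (f : Hom K b c) (g : Hom K a b)
    (f' : @Hom G' K' b c) (g' : @Hom G' K' a b) :
  rel0 (R b c) f f' -> rel0 (R a b) g g' ->
  rel2 (R a c) (phi0 f g) (phi0 f' g').
Proof.
intros hf hg; apply (rel_fid (rel_tensor RK a b c)); now split.
Qed.

Lemma rel_phi0V (f : Hom K b c) (g : Hom K a b)
    (f' : @Hom G' K' b c) (g' : @Hom G' K' a b) :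
  rel0 (R b c) f f' -> rel0 (R a b) g g' ->
  rel2 (R a c) (phi0V f g) (phi0V f' g').
Proof.
intros hf hg; apply (rel_fidV (rel_tensor RK a b c)); now split.
Qed.
End Tensor.

Lemma rel_one1 (a : G) : rel0 (R a a) (one1 K a) (@one1 G' K' a).
Proof. now apply (rel_f0 (rel_tunit RK a)). Qed.

Lemma rel_unit_i (a : G) : rel1 (R a a) (unit_i K a) (@unit_i G' K' a).
Proof. now apply (rel_f1 (rel_tunit RK a)). Qed.

Lemma rel_unit_phi (a : G) : rel2 (R a a) (unit_phi K a) (@unit_phi G' K' a).
Proof. now apply (rel_fid (rel_tunit RK a)). Qed.

Section Functors.
Variables (X X' : bicat) (RX : bcover X X') (a b c : G).

Lemma rel_ften (P : fdata X (Hom K b c)) (Q : fdata X (Hom K a b))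
    (P' : fdata X' (@Hom G' K' b c)) (Q' : fdata X' (@Hom G' K' a b)) :
  rel_fun RX (R b c) P P' -> rel_fun RX (R a b) Q Q' ->
  rel_fun RX (R a c) (P ⊠ Q) (P' ⊠ Q').
Proof.
intros hP hQ; eapply rel_fcompose; [apply rel_tensor | now apply rel_fpair].
Qed.

Lemma rel_funit : rel_fun RX (R a a) (funit K X a) (@funit G' K' X' a).
Proof. eapply rel_fcompose; [apply rel_tunit | apply rel_fbang]. Qed.

Lemma rel_tten (P P1 : fdata X (Hom K b c)) (Q Q1 : fdata X (Hom K a b))
    (t : tdata P P1) (s : tdata Q Q1)
    (P' P1' : fdata X' (@Hom G' K' b c)) (Q' Q1' : fdata X' (@Hom G' K' a b))
    (t' : tdata P' P1') (s' : tdata Q' Q1') :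
  rel_fun RX (R b c) P P' -> rel_fun RX (R b c) P1 P1' ->
  rel_fun RX (R a b) Q Q' -> rel_fun RX (R a b) Q1 Q1' ->
  rel_tdata RX (R b c) t t' -> rel_tdata RX (R a b) s s' ->
  rel_tdata RX (R a c) (t ⊠₁ s) (t' ⊠₁ s').
Proof.
intros hP hP1 hQ hQ1 ht hs; split; cbn; intros; unify_lifts.
- apply rel_ten1; rel.
- apply (@rel_vcomp _ _ (R a c)); [apply (@rel_vcomp _ _ (R a c)) |].
  + apply rel_phiV; rel.
  + apply rel_ten2; rel.
  + apply rel_phi; rel.
Qed.
End Functors.
End Composition.

Ltac rel_tensor_step :=
  lazymatch goal with
  | |- rel_fun _ _ _ (_ ⊠ _) => apply rel_ften
  | |- rel_fun _ _ _ (funit _ _ _) => apply rel_funit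
  | |- rel_tdata _ _ _ (_ ⊠₁ _) => apply rel_tten
  end.

Ltac rel_extension ::= first [rel_functor_step | rel_tensor_step].

Record tri_adj_cover (T : tri_adj G) (T' : tri_adj G') := TriAdjCover {
  base_cover :> tri_comp_cover T T';
  rel_aeqv : forall a b c d : G,
    rel_adjeqv (prod_bcover (hom_cover base_cover c d)
        (prod_bcover (hom_cover base_cover b c) (hom_cover base_cover a b)))
      (hom_cover base_cover a d) (aeqv T a b c d) (@aeqv G' T' a b c d);
  rel_leqv : forall a b : G,
    rel_adjeqv (hom_cover base_cover a b) (hom_cover base_cover a b)
      (leqv T a b) (@leqv G' T' a b);
  rel_reqv : forall a b : G,
    rel_adjeqv (hom_cover base_cover a b) (hom_cover base_cover a b)
      (reqv T a b) (@reqv G' T' a b) }.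

Lemma tri_adj_descent (T : tri_adj G) (K' : tri_comp G')
    (RK : tri_comp_cover T K') :
  exists (T' : tri_adj G') (RT : tri_adj_cover T T'), forall a b,
    bcover_cover (hom_cover RT a b) = bcover_cover (hom_cover RK a b).
Proof.
pose (R := hom_cover RK).
(* The obligations left by [adjeqv_descent], relatedness of the functors at both ends of each
   equivalence, are discharged by [rel]. *)
unshelve (refine (let T' := @TriAdj G' K'
    (fun a b c d => some (@adjeqv_descent _ _ _ _
       (prod_bcover (R c d) (prod_bcover (R b c) (R a b))) (R a d)
       _ _ _ _ _ _ (aeqv T a b c d)))
    (fun a b => some (@adjeqv_descent _ _ _ _ (R a b) (R a b)
       _ _ _ _ _ _ (leqv T a b)))
    (fun a b => some (@adjeqv_descent _ _ _ _ (R a b) (R a b)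
       _ _ _ _ _ _ (reqv T a b))) in _)); try (unfold R; rel).
exists T'; now exists (@TriAdjCover T T' RK
  (fun _ _ _ _ => someP _) (fun _ _ => someP _) (fun _ _ => someP _)).
Qed.

Section AssociatorsAndUnitors.
Variables (T : tri_adj G) (T' : tri_adj G') (RT : tri_adj_cover T T').
Local Notation R := (hom_cover RT).
Variables (X X' : bicat) (RX : bcover X X').

(** Whiskering evaluates the associator at a triple, so the relation over the triple product is
    assembled from those of the three functors. *)
Lemma rel_at_a (a b c d : G) (P : fdata X (Hom T c d))
    (Q : fdata X (Hom T b c)) (S : fdata X (Hom T a b))
    (P' : fdata X' (@Hom G' T' c d)) (Q' : fdata X' (@Hom G' T' b c))
    (S' : fdata X' (@Hom G' T' a b)) :
  rel_fun RX (R c d) P P' -> rel_fun RX (R b c) Q Q' ->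
  rel_fun RX (R a b) S S' ->
  rel_tdata RX (R a d) (at_a P Q S) (at_a P' Q' S').
Proof.
intros hP hQ hS; split; [intros x x' h | intros x y f x' y' f' h].
- refine (@rel_tc _ _ _ _ _ _ _ _ _ _ _ _ (rel_fwd (rel_aeqv RT a b c d))
    (P x, (Q x, S x)) (P' x', (Q' x', S' x')) _).
  exact (conj (rel_f0 hP h) (conj (rel_f0 hQ h) (rel_f0 hS h))).
- refine (@rel_tn _ _ _ _ _ _ _ _ _ _ _ _ (rel_fwd (rel_aeqv RT a b c d))
    (P x, (Q x, S x)) (P y, (Q y, S y)) (f1 P f, (f1 Q f, f1 S f))
    (P' x', (Q' x', S' x')) (P' y', (Q' y', S' y'))
    (f1 P' f', (f1 Q' f', f1 S' f')) _).
  exact (conj (rel_f1 hP h) (conj (rel_f1 hQ h) (rel_f1 hS h))).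
Qed.

Lemma rel_at_l (a b : G) (P : fdata X (Hom T a b))
    (P' : fdata X' (@Hom G' T' a b)) :
  rel_fun RX (R a b) P P' ->
  rel_tdata RX (R a b) (at_l P) (at_l P').
Proof.
intros hP; split; intros.
- apply (rel_tc (rel_fwd (rel_leqv RT a b))); rel.
- apply (rel_tn (rel_fwd (rel_leqv RT a b))); rel.
Qed.

Lemma rel_at_rV (a b : G) (P : fdata X (Hom T a b))
    (P' : fdata X' (@Hom G' T' a b)) :
  rel_fun RX (R a b) P P' ->
  rel_tdata RX (R a b) (at_rV P) (at_rV P').
Proof.
intros hP; split; intros.
- apply (rel_tc (rel_bwd (rel_reqv RT a b))); rel.
- apply (rel_tn (rel_bwd (rel_reqv RT a b))); rel.
Qed.
End AssociatorsAndUnitors.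

Ltac rel_constraint_step :=
  lazymatch goal with
  | |- rel_tdata _ _ _ (at_a _ _ _) => apply rel_at_a
  | |- rel_tdata _ _ _ (at_l _) => apply rel_at_l
  | |- rel_tdata _ _ _ (at_rV _) => apply rel_at_rV
  end.

Ltac rel_extension ::=
  first [rel_functor_step | rel_tensor_step | rel_constraint_step].

Record tri_data_cover (T : tri_data G) (T' : tri_data G') := TriDataCover {
  adj_cover :> tri_adj_cover T T';
  rel_pi : forall a b c d e : G,
    rel_modif (prod_bcover (hom_cover adj_cover d e)
        (prod_bcover (hom_cover adj_cover c d)
          (prod_bcover (hom_cover adj_cover b c) (hom_cover adj_cover a b))))
      (hom_cover adj_cover a e) (pi T a b c d e) (@pi G' T' a b c d e);
  rel_mu : forall a b c : G,
    rel_modif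
      (prod_bcover (hom_cover adj_cover b c) (hom_cover adj_cover a b))
      (hom_cover adj_cover a c) (mu T a b c) (@mu G' T' a b c);
  rel_lambda : forall a b c : G,
    rel_modif
      (prod_bcover (hom_cover adj_cover b c) (hom_cover adj_cover a b))
      (hom_cover adj_cover a c) (lambda T a b c) (@lambda G' T' a b c);
  rel_rho : forall a b c : G,
    rel_modif
      (prod_bcover (hom_cover adj_cover b c) (hom_cover adj_cover a b))
      (hom_cover adj_cover a c) (rho T a b c) (@rho G' T' a b c) }.

(** The four modifications descend over their pasted boundaries, whose relatedness [rel] derives
    from the whiskered associators and unitors. *)
Lemma tri_data_descent (T : tri_data G) (A' : tri_adj G')
    (RA : tri_adj_cover T A') :
  exists (T' : tri_data G') (RT : tri_data_cover T T'), forall a b,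
    bcover_cover (hom_cover RT a b) = bcover_cover (hom_cover RA a b).
Proof.
pose (R := hom_cover RA).
unshelve (refine (let T' := @TriData G' A'
    (fun a b c d e => some (@modif_descent _ _ _ _
       (prod_bcover (R d e)
         (prod_bcover (R c d) (prod_bcover (R b c) (R a b)))) (R a e)
       _ _ _ _ _ _ _ _ _ _ _ _ (pi T a b c d e)))
    (fun a b c => some (@modif_descent _ _ _ _
       (prod_bcover (R b c) (R a b)) (R a c)
       _ _ _ _ _ _ _ _ _ _ _ _ (mu T a b c)))
    (fun a b c => some (@modif_descent _ _ _ _
       (prod_bcover (R b c) (R a b)) (R a c)
       _ _ _ _ _ _ _ _ _ _ _ _ (lambda T a b c)))
    (fun a b c => some (@modif_descent _ _ _ _
       (prod_bcover (R b c) (R a b)) (R a c)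
       _ _ _ _ _ _ _ _ _ _ _ _ (rho T a b c))) in _)); try (unfold R; rel).
exists T'; now exists (@TriDataCover T T' RA (fun _ _ _ _ _ => someP _)
  (fun _ _ _ => someP _) (fun _ _ _ => someP _) (fun _ _ _ => someP _)).
Qed.

(** * Relatedness of the components of the constraints *)

Section Components.
Variables (T : tri_data G) (T' : tri_data G') (RT : tri_data_cover T T').
Local Notation R := (hom_cover RT).
Local Notation "'Hom''" := (@Hom G' T').

Section Associator.
Variables (a b c d : G).
Local Notation A := (rel_aeqv RT a b c d).

Section Objects.
Variables (h : Hom T c d) (g : Hom T b c) (f : Hom T a b).
Variables (h' : Hom' c d) (g' : Hom' b c) (f' : Hom' a b).
Hypotheses (rh : rel0 (R c d) h h') (rg : rel0 (R b c) g g').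
Hypotheses (rf : rel0 (R a b) f f').

Lemma rel_a1 : rel1 (R a d) (a1 h g f) (a1 h' g' f').
Proof.
exact (@rel_tc _ _ _ _ _ _ _ _ _ _ _ _ (rel_fwd A)
  (h, (g, f)) (h', (g', f')) (conj rh (conj rg rf))).
Qed.

Lemma rel_aV1 : rel1 (R a d) (aV1 h g f) (aV1 h' g' f').
Proof.
exact (@rel_tc _ _ _ _ _ _ _ _ _ _ _ _ (rel_bwd A)
  (h, (g, f)) (h', (g', f')) (conj rh (conj rg rf))).
Qed.

Lemma rel_a_eta : rel2 (R a d) (a_eta h g f) (a_eta h' g' f').
Proof.
exact (@rel_mc _ _ _ _ _ _ _ _ _ _ _ _ _ _ _ _ (rel_aunit A)
  (h, (g, f)) (h', (g', f')) (conj rh (conj rg rf))).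
Qed.

Lemma rel_a_eps : rel2 (R a d) (a_eps h g f) (a_eps h' g' f').
Proof.
exact (@rel_mc _ _ _ _ _ _ _ _ _ _ _ _ _ _ _ _ (rel_acounit A)
  (h, (g, f)) (h', (g', f')) (conj rh (conj rg rf))).
Qed.
End Objects.

Section Morphisms.
Variables (h k : Hom T c d) (g p : Hom T b c) (f q : Hom T a b).
Variables (h' k' : Hom' c d) (g' p' : Hom' b c) (f' q' : Hom' a b).
Variables (α : cell1 h k) (β : cell1 g p) (γ : cell1 f q).
Variables (α' : cell1 h' k') (β' : cell1 g' p') (γ' : cell1 f' q').
Hypotheses (rα : rel1 (R c d) α α') (rβ : rel1 (R b c) β β').
Hypotheses (rγ : rel1 (R a b) γ γ').

Lemma rel_a2 : rel2 (R a d) (a2 α β γ) (a2 α' β' γ').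
Proof.
exact (@rel_tn _ _ _ _ _ _ _ _ _ _ _ _ (rel_fwd A)
  (h, (g, f)) (k, (p, q)) (α, (β, γ))
  (h', (g', f')) (k', (p', q')) (α', (β', γ')) (conj rα (conj rβ rγ))).
Qed.

Lemma rel_a2V : rel2 (R a d) (a2V α β γ) (a2V α' β' γ').
Proof.
exact (@rel_tnV _ _ _ _ _ _ _ _ _ _ _ _ (rel_fwd A)
  (h, (g, f)) (k, (p, q)) (α, (β, γ))
  (h', (g', f')) (k', (p', q')) (α', (β', γ')) (conj rα (conj rβ rγ))).
Qed.

Lemma rel_aV2 : rel2 (R a d) (aV2 α β γ) (aV2 α' β' γ').
Proof.
exact (@rel_tn _ _ _ _ _ _ _ _ _ _ _ _ (rel_bwd A)
  (h, (g, f)) (k, (p, q)) (α, (β, γ))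
  (h', (g', f')) (k', (p', q')) (α', (β', γ')) (conj rα (conj rβ rγ))).
Qed.
End Morphisms.
End Associator.

Section Unitors.
Variables (a b : G) (f g : Hom T a b) (f' g' : Hom' a b).
Variables (α : cell1 f g) (α' : cell1 f' g').
Hypotheses (rf : rel0 (R a b) f f') (rα : rel1 (R a b) α α').

Lemma rel_l1 : rel1 (R a b) (l1 f) (l1 f').
Proof. exact (rel_tc (rel_fwd (rel_leqv RT a b)) rf). Qed.

Lemma rel_lV1 : rel1 (R a b) (lV1 f) (lV1 f').
Proof. exact (rel_tc (rel_bwd (rel_leqv RT a b)) rf). Qed.

Lemma rel_l2 : rel2 (R a b) (l2 α) (l2 α').
Proof. exact (rel_tn (rel_fwd (rel_leqv RT a b)) rα). Qed.

Lemma rel_lV2 : rel2 (R a b) (lV2 α) (lV2 α').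
Proof. exact (rel_tn (rel_bwd (rel_leqv RT a b)) rα). Qed.

Lemma rel_l_eta : rel2 (R a b) (l_eta f) (l_eta f').
Proof. exact (rel_mc (rel_aunit (rel_leqv RT a b)) rf). Qed.

Lemma rel_l_eps : rel2 (R a b) (l_eps f) (l_eps f').
Proof. exact (rel_mc (rel_acounit (rel_leqv RT a b)) rf). Qed.

Lemma rel_r1 : rel1 (R a b) (r1 f) (r1 f').
Proof. exact (rel_tc (rel_fwd (rel_reqv RT a b)) rf). Qed.

Lemma rel_rV1 : rel1 (R a b) (rV1 f) (rV1 f').
Proof. exact (rel_tc (rel_bwd (rel_reqv RT a b)) rf). Qed.

Lemma rel_r2 : rel2 (R a b) (r2 α) (r2 α').
Proof. exact (rel_tn (rel_fwd (rel_reqv RT a b)) rα). Qed.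

Lemma rel_rV2 : rel2 (R a b) (rV2 α) (rV2 α').
Proof. exact (rel_tn (rel_bwd (rel_reqv RT a b)) rα). Qed.

Lemma rel_r_eta : rel2 (R a b) (r_eta f) (r_eta f').
Proof. exact (rel_mc (rel_aunit (rel_reqv RT a b)) rf). Qed.

Lemma rel_r_eps : rel2 (R a b) (r_eps f) (r_eps f').
Proof. exact (rel_mc (rel_acounit (rel_reqv RT a b)) rf). Qed.
End Unitors.

Lemma rel_pi3 (a b c d e : G) (k : Hom T d e) (h : Hom T c d)
    (g : Hom T b c) (f : Hom T a b)
    (k' : Hom' d e) (h' : Hom' c d) (g' : Hom' b c) (f' : Hom' a b) :
  rel0 (R d e) k k' -> rel0 (R c d) h h' -> rel0 (R b c) g g' ->
  rel0 (R a b) f f' ->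
  rel2 (R a e) (pi3 k h g f) (pi3 k' h' g' f').
Proof.
intros rk rh rg rf.
exact (@rel_mc _ _ _ _ _ _ _ _ _ _ _ _ _ _ _ _ (rel_pi RT a b c d e)
  (k, (h, (g, f))) (k', (h', (g', f'))) (conj rk (conj rh (conj rg rf)))).
Qed.

Section UnitModifications.
Variables (a b c : G) (g : Hom T b c) (f : Hom T a b).
Variables (g' : Hom' b c) (f' : Hom' a b).
Hypotheses (rg : rel0 (R b c) g g') (rf : rel0 (R a b) f f').

Lemma rel_mu3 : rel2 (R a c) (mu3 g f) (mu3 g' f').
Proof.
exact (@rel_mc _ _ _ _ _ _ _ _ _ _ _ _ _ _ _ _ (rel_mu RT a b c)
  (g, f) (g', f') (conj rg rf)).
Qed.

Lemma rel_lambda3 : rel2 (R a c) (lambda3 g f) (lambda3 g' f').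
Proof.
exact (@rel_mc _ _ _ _ _ _ _ _ _ _ _ _ _ _ _ _ (rel_lambda RT a b c)
  (g, f) (g', f') (conj rg rf)).
Qed.

Lemma rel_rho3 : rel2 (R a c) (rho3 g f) (rho3 g' f').
Proof.
exact (@rel_mc _ _ _ _ _ _ _ _ _ _ _ _ _ _ _ _ (rel_rho RT a b c)
  (g, f) (g', f') (conj rg rf)).
Qed.
End UnitModifications.
End Components.
End TricategoryRelations.

Ltac rel_component_step :=
  lazymatch goal with
  | |- rel0 _ _ (_ ⊗ _) => apply rel_ten0
  | |- rel0 _ _ (one1 _ _) => apply rel_one1
  | |- rel1 _ _ (_ ⊗₁ _) => apply rel_ten1
  | |- rel1 _ _ (unit_i _ _) => apply rel_unit_i
  | |- rel1 _ _ (a1 _ _ _) => apply rel_a1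
  | |- rel1 _ _ (aV1 _ _ _) => apply rel_aV1
  | |- rel1 _ _ (l1 _) => apply rel_l1
  | |- rel1 _ _ (lV1 _) => apply rel_lV1
  | |- rel1 _ _ (r1 _) => apply rel_r1
  | |- rel1 _ _ (rV1 _) => apply rel_rV1
  | |- rel2 _ _ (_ ⊗₂ _) => apply rel_ten2
  | |- rel2 _ _ (unit_phi _ _) => apply rel_unit_phi
  | |- rel2 _ _ (phi _ _ _ _) => apply rel_phi
  | |- rel2 _ _ (phi0 _ _) => apply rel_phi0
  | |- rel2 _ _ (a2 _ _ _) => apply rel_a2
  | |- rel2 _ _ (aV2 _ _ _) => apply rel_aV2
  | |- rel2 _ _ (a_eta _ _ _) => apply rel_a_eta
  | |- rel2 _ _ (a_eps _ _ _) => apply rel_a_eps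
  | |- rel2 _ _ (l2 _) => apply rel_l2
  | |- rel2 _ _ (lV2 _) => apply rel_lV2
  | |- rel2 _ _ (l_eta _) => apply rel_l_eta
  | |- rel2 _ _ (l_eps _) => apply rel_l_eps
  | |- rel2 _ _ (r2 _) => apply rel_r2
  | |- rel2 _ _ (rV2 _) => apply rel_rV2
  | |- rel2 _ _ (r_eta _) => apply rel_r_eta
  | |- rel2 _ _ (r_eps _) => apply rel_r_eps
  | |- rel2 _ _ (pi3 _ _ _ _) => apply rel_pi3
  | |- rel2 _ _ (mu3 _ _) => apply rel_mu3
  | |- rel2 _ _ (lambda3 _ _) => apply rel_lambda3
  | |- rel2 _ _ (rho3 _ _) => apply rel_rho3
  | |- rel2 _ _ (phiV _ _ _ _) => apply rel_phiV
  | |- rel2 _ _ (phi0V _ _) => apply rel_phi0V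
  | |- rel2 _ _ (a2V _ _ _) => apply rel_a2V
  end.

(** The pasting operators are composites of structure cells, so unfolding them reduces the axioms to
    steps already covered. *)
Ltac rel_pasting_step :=
  lazymatch goal with
  | |- rel2 _ _ (a_left _ _ _) => unfold a_left
  | |- rel2 _ _ (a_right _ _ _) => unfold a_right
  | |- rel2 _ _ (whl _ _) => unfold whl
  | |- rel2 _ _ (rw12 _ _) => unfold rw12
  | |- rel2 _ _ (rw22 _ _) => unfold rw22
  | |- rel2 _ _ (rw30 _ _) => unfold rw30
  | |- rel2 _ _ (rw32 _ _) => unfold rw32
  | |- rel2 _ _ (nest3 _ _ _ _) => unfold nest3
  | |- rel2 _ _ (merge_r _ _ _) => unfold merge_r
  | |- rel2 _ _ (split_r _ _ _) => unfold split_r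
  | |- rel2 _ _ (merge3_r _ _ _ _) => unfold merge3_r
  | |- rel2 _ _ (ten_r12 _ _) => unfold ten_r12
  | |- rel2 _ _ (ten_r32 _ _) => unfold ten_r32
  | |- rel2 _ _ (ten_r30 _ _) => unfold ten_r30
  | |- rel2 _ _ (merge_l _ _ _) => unfold merge_l
  | |- rel2 _ _ (split_l _ _ _) => unfold split_l
  | |- rel2 _ _ (merge3_l _ _ _ _) => unfold merge3_l
  | |- rel2 _ _ (ten_l12 _ _) => unfold ten_l12
  | |- rel2 _ _ (ten_l32 _ _) => unfold ten_l32
  | |- rel2 _ _ (ten_l30 _ _) => unfold ten_l30
  end.

Ltac rel_extension ::= first [rel_component_step | rel_pasting_step].

(** The axioms quantify over 1-morphisms only. Lifting these gives an instance in [T], and the two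
    pastings in [D'] are related to its two sides cell by cell. *)
Lemma tricat_descent (G : gset3) (H' : G -> G -> gset2) (T : tricat_on G)
    (D' : tri_data (GSet3 H')) (RD : tri_data_cover T D') :
  associahedron_axiom D' /\ left_normalization_axiom D' /\
  right_normalization_axiom D'.
Proof.
pose (R := hom_cover RD).
split; [| split].
- intros a b c d e e' k' j' h' g' f'.
  destruct (lift0 (R e e') k') as [k hk], (lift0 (R d e) j') as [j hj].
  destruct (lift0 (R c d) h') as [h hh], (lift0 (R b c) g') as [g hg].
  destruct (lift0 (R a b) f') as [f hf].
  apply (rel2_eq (R := R a e') (@associahedron _ T _ _ _ _ _ _ k j h g f));
    unfold R in *.
  + rel.
  + rel.
- intros a b c d h' g' f'.
  destruct (lift0 (R c d) h') as [h hh], (lift0 (R b c) g') as [g hg].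
  destruct (lift0 (R a b) f') as [f hf].
  apply (rel2_eq (R := R a d) (@left_normalization _ T _ _ _ _ h g f));
    unfold R in *; rel.
- intros a b c d h' g' f'.
  destruct (lift0 (R c d) h') as [h hh], (lift0 (R b c) g') as [g hg].
  destruct (lift0 (R a b) f') as [f hf].
  apply (rel2_eq (R := R a d) (@right_normalization _ T _ _ _ _ h g f));
    unfold R in *; rel.
Qed.

(** * The quotient by a coherence-3-system *)

Section HeterogeneousEquality.
Variable G : gset2.

(** Packing a 1-cell with its endpoints turns heterogeneous equality into equality of dependent
    pairs, whose second components agree by uniqueness of identity proofs. *)
Lemma eq1_eq (x y : G) (f g : cell1 x y) : eq1 f g -> f = g.
Proof.
intros e.
assert (p : existT (fun x => {y : G & cell1 x y}) x (existT _ y f) =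
            existT (fun x => {y : G & cell1 x y}) x (existT _ y g))
  by now destruct e.
exact (inj_pairT2 _ _ _ _ _ (inj_pairT2 _ _ _ _ _ p)).
Qed.

Lemma eq2_sym (x y x' y' : G) (f g : cell1 x y) (f' g' : cell1 x' y')
    (m : cell2 f g) (m' : cell2 f' g') : eq2 m m' -> eq2 m' m.
Proof. now intros []. Qed.

Lemma eq2_pair (x y : G) (f g f' g' : cell1 x y)
    (m : cell2 f g) (m' : cell2 f' g') :
  eq2 m m' ->
  existT (fun f => {g : cell1 x y & cell2 f g}) f (existT _ g m) =
  existT (fun f => {g : cell1 x y & cell2 f g}) f' (existT _ g' m').
Proof.
intros e.
pose (P := fun x y : G => {f : cell1 x y & {g : cell1 x y & cell2 f g}}).
assert (p : existT (fun x => {y : G & P x y}) x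
      (existT _ y (existT _ f (existT _ g m))) =
    existT (fun x => {y : G & P x y}) x
      (existT _ y (existT _ f' (existT _ g' m')))) by now destruct e.
exact (inj_pairT2 _ _ _ _ _ (inj_pairT2 _ _ _ _ _ p)).
Qed.

Lemma eq2_eq (x y : G) (f g : cell1 x y) (m m' : cell2 f g) :
  eq2 m m' -> m = m'.
Proof.
intros e.
exact (inj_pairT2 _ _ _ _ _ (inj_pairT2 _ _ _ _ _ (eq2_pair e))).
Qed.
End HeterogeneousEquality.

(** * Classes of 2- and 3-morphisms and the cover they form *)

Section QuotientCover.
Variables (G : gset3) (T : tricat_on G) (C : family3 G).
Hypothesis hC : coherence_3_system T C.

Lemma class2_eq (a b : G) (f g : Hom T a b) (α β : cell1 f g) :
  class2 C α = class2 C β <-> sim2 C α β.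
Proof.
split.
(* The relation [sim2 C α β] says that [β] is a member of the class of [α], and [β] belongs to its
   own class through its identity. *)
- intros e; change (proj1_sig (class2 C α) β); rewrite e.
  exists (id2 β); apply (coh_id hC).
- intros [k hk]; apply subset_eq_compat, functional_extensionality; intros γ.
  destruct (coh_inv hC hk) as (kV & hkV & _).
  apply propositional_extensionality; split; intros [l hl].
  + exists (l ∘ kV); now apply (coh_circ hC).
  + exists (l ∘ k); now apply (coh_circ hC).
Qed.

Section LocalCells.
Variables (a b : G) (f g : Hom T a b).

(** The relation [sim3] rewritten as a commuting square whose two sides in [C] both point from [Π]
    to [Λ]; such squares paste, and they have the form required by [rel2_inj]. *)
Definition conjugate3 (Π Λ : mor3 f g) : Prop :=
  exists (k : cell2 (src Π) (src Λ)) (l : cell2 (tgt Π) (tgt Λ)),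
    C k /\ C l /\ l ∘ mor Π = mor Λ ∘ k.

Lemma sim3_conjugate (Π Λ : mor3 f g) : sim3 C Π Λ <-> conjugate3 Π Λ.
Proof.
split.
- intros (l & k & hl & hk & e).
  destruct (coh_inv hC hk) as (kV & hkV & e1 & e2).
  exists kV, l; repeat split; [assumption .. |].
  now rewrite <- e, !vcompA, e2, vcompIr.
- intros (k & l & hk & hl & e).
  destruct (coh_inv hC hk) as (kV & hkV & e1 & e2).
  exists l, kV; repeat split; [assumption .. |].
  now rewrite e, vcompA, e2, vcompIr.
Qed.

Lemma conjugate3_refl (Π : mor3 f g) : conjugate3 Π Π.
Proof.
exists (id2 _), (id2 _); repeat split; [apply (coh_id hC) .. |].
now rewrite vcompIl, vcompIr.
Qed.

Lemma conjugate3_sym (Π Λ : mor3 f g) : conjugate3 Π Λ -> conjugate3 Λ Π.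
Proof.
intros (k & l & hk & hl & e).
destruct (coh_inv hC hk) as (kV & hkV & e1 & e2).
destruct (coh_inv hC hl) as (lV & hlV & e3 & e4).
exists kV, lV; repeat split; [assumption .. |].
symmetry; exact (inverse_square e2 e3 (eq_sym e)).
Qed.

Lemma conjugate3_trans (Π Λ Ω : mor3 f g) :
  conjugate3 Π Λ -> conjugate3 Λ Ω -> conjugate3 Π Ω.
Proof.
intros (k & l & hk & hl & e) (k' & l' & hk' & hl' & e').
exists (k' ∘ k), (l' ∘ l); repeat split; [now apply (coh_circ hC) .. |].
now rewrite vcompA, e, <- vcompA, e', vcompA.
Qed.

Lemma sim3_eq (Π Λ : mor3 f g) : sim3 C Π = sim3 C Λ <-> conjugate3 Π Λ.
Proof.
split.
- intros e; apply sim3_conjugate; rewrite e.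
  apply sim3_conjugate, conjugate3_refl.
- intros h; apply functional_extensionality; intros Ω.
  apply propositional_extensionality; rewrite !sim3_conjugate.
  split; intros h'; (eapply conjugate3_trans; [| exact h']);
    auto using conjugate3_sym.
Qed.

(** By proof irrelevance a class is determined by its boundary and its underlying subset. *)
Lemma quot3_eq2 (x y x' y' : quot2 C f g) (X : quot3 x y) (Y : quot3 x' y') :
  x = x' -> y = y' -> proj1_sig X = proj1_sig Y ->
  @eq2 (hom (g := quotient T C) a b) f g x y X f g x' y' Y.
Proof.
intros <- <-; destruct X as [S p], Y as [S' p']; cbn; intros <-.
now rewrite (proof_irrelevance _ p p').
Qed.

Lemma class3_eq2 (α β α' β' : cell1 f g) (Π : cell2 α β) (Λ : cell2 α' β') :
  @eq2 (hom (g := quotient T C) a b) f g _ _ (class3 C Π) f g _ _ (class3 C Λ)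
  <-> conjugate3 (Mor3 Π) (Mor3 Λ).
Proof.
split.
- intros e; apply sim3_eq.
  exact (f_equal (fun p => proj1_sig (projT2 (projT2 p))) (eq2_pair e)).
- intros h; pose proof h as (k & l & hk & hl & _).
  apply quot3_eq2; [apply class2_eq; now exists k | apply class2_eq; now exists l |].
  now apply sim3_eq.
Qed.

(** Conjugating any representative by cells of [C] moves its boundary to the prescribed [α] and [β].
    This gives fullness of the quotient map on 3-morphisms. *)
Lemma class3_surj (α β : cell1 f g) (X : quot3 (class2 C α) (class2 C β)) :
  exists Π : cell2 α β, class3 C Π = X.
Proof.
destruct X as [S [[α' β' Π] (e1 & e2 & ->)]]; cbn in *.
destruct (proj1 (class2_eq _ _) e1) as [k hk].
destruct (proj1 (class2_eq _ _) e2) as [l hl].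
destruct (coh_inv hC hk) as (kV & hkV & e3 & e4).
exists (l ∘ Π ∘ kV); apply subset_eq_compat, sim3_eq, conjugate3_sym.
exists k, l; cbn; repeat split; [assumption .. |].
now rewrite vcompA, e3, vcompIr.
Qed.
End LocalCells.

(** Relatedness is the graph of the class map, and [ker] is [C]. The heterogeneous equalities let
    the boundary in the quotient vary freely. *)
Definition quotient_cover (a b : G) :
  cover (Hom T a b) (hom (g := quotient T C) a b).
Proof.
pose (Q := hom (g := quotient T C) a b).
unshelve (refine (@Cover (Hom T a b) Q (fun x x' => x = x')
  (fun x y x' y' f f' => @eq1 Q x y (class2 C f) x' y' f')
  (fun x y f g x' y' f' g' m m' =>
     @eq2 Q x y _ _ (class3 C m) x' y' f' g' m')
  (fun x y f g k => C k) _ _ _ _ _ _ _ _ _ _ _ _ _ _ _ _ _ _ _ _)).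
- now intros x y x' y' f f' [].
- now intros x y x' y' f f' [].
- now intros x y f g x' y' f' g' m m' [].
- now intros x y f g x' y' f' g' m m' [].
- intros x; now exists x.
- intros x; now exists x.
- now intros x y z -> ->.
- intros x y x' y' f' <- <-; destruct f' as [S [f ->]].
  exists f; constructor.
- intros x y x' y' f <- <-; exists (class2 C f); constructor.
- intros x y x' y' f f' g' e; revert g'; destruct e; apply eq1_eq.
- intros x y f g x' y' f' g' m' e; revert g' m'; destruct e; intros g' m' e.
  apply eq1_eq in e; subst g'.
  destruct (class3_surj m') as [m <-]; exists m; constructor.
- intros x y f g x' y' f' g' m e; revert g'; destruct e; intros g' e.
  apply eq1_eq in e; subst g'; exists (class3 C m); constructor.
- intros x y f g x' y' f' g' m m' n' e; revert n'; destruct e; apply eq2_eq.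
- intros x y f g x' y' h' [] e; apply class2_eq.
  symmetry; exact (eq1_eq e).
- intros x y f g k x' y' h' hk []; replace (class2 C f) with (class2 C g).
  + constructor.
  + symmetry; apply class2_eq; now exists k.
- intros x y f g f1 g1 m n x' y' f' g' n' h e.
  revert h; destruct e; intros h; exact (proj1 (class3_eq2 _ _) h).
- intros x y f g f1 g1 m n k l x' y' f' g' n' hk hl e [].
  apply class3_eq2, conjugate3_sym; now exists k, l.
- intros; apply (coh_id hC).
- intros; now apply (coh_star hC).
- intros x y f g k l; apply (coh_parallel hC).
Defined.
End QuotientCover.

(** * Reflexivity of equivalence and biequivalence *)

Lemma iso1_refl (B : bicat) (x y : B) (f : cell1 x y) : iso1 f f.
Proof. exists (id2 f), (id2 f); split; apply vcompIl. Qed.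

Lemma equivalent_refl (B : bicat) (x : B) : equivalent x x.
Proof.
exists (id1 x), (id1 x); split.
- exists (lunitV (id1 x)), (lunit (id1 x)).
  split; [apply lunitVK_on | apply lunitK_on].
- exists (lunit (id1 x)), (lunitV (id1 x)).
  split; [apply lunitK_on | apply lunitVK_on].
Qed.

(** The left unitor at the unit 1-morphism makes [one1 T a ⊗ one1 T a] equivalent to [one1 T a]; the
    unit and counit of its adjoint equivalence are the invertible cells. *)
Lemma biequivalent_refl (G : gset3) (T : tricat_on G) (a : G) :
  biequivalent T a a.
Proof.
assert (e : @equivalent (Hom T a a) (one1 T a ⊗ one1 T a) (one1 T a)).
{ exists (l1 (one1 T a)), (lV1 (one1 T a)); split.
  - exists (l_eta (one1 T a)), (mcV (aunit (leqv T a a)) (one1 T a)).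
    split; [apply (mcK (aunit (leqv T a a)))
           | apply (mcVK (aunit (leqv T a a)))].
  - exists (l_eps (one1 T a)), (mcV (acounit (leqv T a a)) (one1 T a)).
    split; [apply (mcK (acounit (leqv T a a)))
           | apply (mcVK (acounit (leqv T a a)))]. }
now exists (one1 T a), (one1 T a).
Qed.

(** * The quotient tricategory and the quotient functor *)

Section QuotientTricategory.
Variables (G : gset3) (T : tricat_on G) (C : family3 G).
Hypothesis hC : coherence_3_system T C.

(** The stages of the structure descend one after another; the equations they return compose, so
    that relatedness in the final cover still means being the class of a cell. *)
Lemma quotient_descent :
  exists (Q : tricat_on (quotient T C))
    (RQ : @tri_data_cover G (@hom (quotient T C)) T Q),
  forall a b, bcover_cover (hom_cover RQ a b) = quotient_cover hC a b.
Proof.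
destruct (@tri_comp_descent G (@hom (quotient T C)) T (quotient_cover hC))
  as (K' & RK & eK).
{ intros; now apply (coh_tensor hC). }
destruct (tri_adj_descent RK) as (A' & RA & eA).
destruct (tri_data_descent RA) as (D' & RD & eD).
destruct (tricat_descent RD) as (h1 & h2 & h3).
exists (@TricatOn (quotient T C) D' h1 h2 h3), RD; intros a b.
now rewrite eD, eA, eK.
Qed.

Variables (Q : tricat_on (quotient T C)).
Variable RQ : @tri_data_cover G (@hom (quotient T C)) T Q.
Hypothesis eQ :
  forall a b, bcover_cover (hom_cover RQ a b) = quotient_cover hC a b.
Local Notation R := (hom_cover RQ).
Local Notation F := (quotient_map T C).

Lemma rel0_quotient (a b : G) (f : Hom T a b) : rel0 (R a b) f (F1 Q F f).
Proof. now rewrite eQ. Qed.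

Lemma rel1_quotient (a b : G) (f g : Hom T a b) (α : cell1 f g) :
  rel1 (R a b) α (F2 Q F α).
Proof. rewrite eQ; constructor. Qed.

Lemma rel2_quotient (a b : G) (f g : Hom T a b) (α β : cell1 f g)
    (Π : cell2 α β) : rel2 (R a b) Π (F3 Q F Π).
Proof. rewrite eQ; constructor. Qed.

(** With the cover identified by [eQ], relatedness to a cell of [Q] says that this cell is the
    class. Preservation statements thus become relatedness statements. *)
Lemma rel0_eq (a b : G) (f : Hom T a b) (f' : Hom Q a b) :
  rel0 (R a b) f f' -> F1 Q F f = f'.
Proof. now rewrite eQ. Qed.

Lemma rel1_eq1 (a b : G) (f g : Hom T a b) (α : cell1 f g)
    (f' g' : Hom Q a b) (α' : cell1 f' g') :
  rel1 (R a b) α α' -> eq1 (F2 Q F α) α'.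
Proof. now rewrite eQ. Qed.

Lemma rel2_eq2 (a b : G) (f g : Hom T a b) (α β : cell1 f g) (Π : cell2 α β)
    (f' g' : Hom Q a b) (α' β' : cell1 f' g') (Π' : cell2 α' β') :
  rel2 (R a b) Π Π' -> eq2 (F3 Q F Π) Π'.
Proof. now rewrite eQ. Qed.

Ltac rel_quotient_step :=
  lazymatch goal with
  | |- rel0 _ _ (F1 _ _ _) => apply rel0_quotient
  | |- rel1 _ _ (F2 _ _ _) => apply rel1_quotient
  | |- rel2 _ _ (F3 _ _ _) => apply rel2_quotient
  end.

Ltac rel_extension ::= first [rel_quotient_step | rel_component_step].

Ltac preserve :=
  intros;
  lazymatch goal with
  | |- @eq (cell0 _) _ _ => apply rel0_eq
  | |- @eq (cell1 _ _) _ _ => apply eq1_eq, rel1_eq1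
  | |- @eq (cell2 _ _) _ _ => apply eq2_eq, rel2_eq2
  | |- eq1 _ _ => apply rel1_eq1
  | |- eq2 _ _ => apply rel2_eq2
  end; rel.

Lemma quotient_preserves_tensor : preserves_tensor T Q F.
Proof. split; preserve. Qed.

Lemma quotient_preserves_star : preserves_star T Q F.
Proof. split; preserve. Qed.

Lemma quotient_preserves_circ : preserves_circ T Q F.
Proof. red; preserve. Qed.

Lemma quotient_preserves_units : preserves_units T Q F.
Proof. split; preserve. Qed.

Lemma quotient_preserves_constraints : preserves_constraints T Q F.
Proof. split; preserve. Qed.
Lemma quotient_local_strict (a b : G) :
  @strict_functor (Hom T a b) (Hom Q a b) (mhom F a b).
Proof.
split; intros.
- exact (pres_id1 quotient_preserves_units x).
- exact (pres_star1 quotient_preserves_star g f).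
- exact (pres_id2 quotient_preserves_units f).
- exact (quotient_preserves_circ n m).
- exact (pres_star2 quotient_preserves_star n m).
- exact (pres_assoc quotient_preserves_constraints h g f).
- exact (pres_lunit quotient_preserves_constraints f).
- exact (pres_runit quotient_preserves_constraints f).
Qed.

(** On 1-cells every class has a representative; on 2-cells fullness is lifting with prescribed
    boundary, and faithfulness comes from uniqueness of parallel cells in [C]. *)
Lemma quotient_local_biequivalence (a b : G) :
  @biequivalence2 (Hom T a b) (Hom Q a b) (mhom F a b).
Proof.
split.
- intros f; exists f; apply equivalent_refl.
- intros f g [S [α ->]]; exists α; apply iso1_refl.
- intros f g α β m n e.
  assert (h : conjugate3 C (Mor3 m) (Mor3 n)).
  { apply (class3_eq2 hC); cbn in e; rewrite e; constructor. }
  destruct h as (k & l & hk & hl & h); cbn in *.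
  (* Here [k] and [l] are endomorphisms in [C], hence identities, and the square reduces to the
     equality of [m] and [n]. *)
  rewrite (coh_parallel hC hk (coh_id hC _)) in h.
  rewrite (coh_parallel hC hl (coh_id hC _)) in h.
  now rewrite vcompIl, vcompIr in h.
- intros f g α β m'; exact (class3_surj hC m').
Qed.

(** Heterogeneous relatedness does not depend on how the boundary is presented, so it survives
    transport. *)
Lemma rel2_eq_rect (a b : G) (f g : Hom T a b) (α β : cell1 f g)
    (Π : cell2 α β) (f' g' : Hom Q a b) (α' β' γ' : cell1 f' g')
    (Π' : cell2 α' β') (e : β' = γ') :
  rel2 (R a b) Π Π' ->
  rel2 (R a b) Π (eq_rect _ (fun y => cell2 α' y) Π' _ e).
Proof. now destruct e. Qed.

(** The equality of the classes of [β] and [γ] provides [k] in [C] from [β] to [γ]. Precomposing [Π]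
    with [k] gives a representative of its class that is composable with [Λ]. *)
Lemma quotient_circ_on_classes : circ_on_classes Q.
Proof.
intros a b f g α β γ δ Π Λ e.
destruct (proj1 (class2_eq hC _ _) e) as [k hk].
assert (h : @eq2 (Hom Q a b) f g _ _ (class3 C (Π ∘ k)) f g _ _ (class3 C Π)).
{ apply (class3_eq2 hC); exists k, (id2 δ).
  repeat split; [assumption | apply (coh_id hC) | apply vcompIl]. }
assert (r : rel2 (R a b) (Π ∘ k) (F3 Q F Π)) by (rewrite eQ; exact h).
exists α, β, δ, (Π ∘ k), Λ; repeat split; [exact h |].
assert (s : @eq2 (Hom Q a b) f g _ _ (F3 Q F (Π ∘ k ∘ Λ)) f g _ _
    (@vcomp (Hom Q a b) f g _ _ _ (F3 Q F Π)
       (eq_rect _ (fun y => @cell2 (Hom Q a b) f g (class2 C α) y)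
          (F3 Q F Λ) _ e))).
{ apply rel2_eq2, rel_vcomp; [exact r | apply rel2_eq_rect, rel2_quotient]. }
exact (eq2_sym s).
Qed.
End QuotientTricategory.

Unset Implicit Arguments.

Theorem proposition3p7p3 (G : gset3) (T : tricat_on G) (C : family3 G)
    (hC : coherence_3_system T C) :
  exists Q : tricat_on (quotient T C),
    (preserves_tensor T Q (quotient_map T C)
     /\ preserves_star T Q (quotient_map T C)
     /\ circ_on_classes Q
     /\ preserves_units T Q (quotient_map T C)
     /\ preserves_constraints T Q (quotient_map T C))
    /\ virtually_strict_triequivalence T Q (quotient_map T C).
Proof.
destruct (quotient_descent hC) as (Q & RQ & eQ).
pose proof (quotient_preserves_tensor eQ) as ht.
pose proof (quotient_preserves_star eQ) as hs.
pose proof (quotient_preserves_circ eQ) as hc.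
pose proof (quotient_preserves_units eQ) as hu.
pose proof (quotient_preserves_constraints eQ) as hk.
pose proof (quotient_circ_on_classes eQ) as hci.
exists Q; split; [exact (conj ht (conj hs (conj hci (conj hu hk)))) |].
split.
- now split.
- intros a; exists a; apply biequivalent_refl.
- intros a b; exact (quotient_local_strict eQ a b).
- intros a b; exact (quotient_local_biequivalence hC Q a b).
Qed.
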